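(* Let $T \in \mathbb{N} \cup \{+\infty\}$, $\mathbb{N}_{\le T} = \{0,\dots,T\}$ (or $\mathbb{N}$ if $T=+\infty$), and $\mathbb{N}_{\le T-1}$ defined analogously. Consider random regressors $M_t \in \mathbb{R}^{m\times n}$, outputs $y_{t+1}\in\mathbb{R}^m$ and noise $w_t \in \mathbb{R}^m$ with $y_{t+1} = M_t\theta^\star + w_t$ for $t \in \mathbb{N}_{\le T-1}$, where $\theta^\star\in\mathbb{R}^n$ is deterministic and unknown. Let $\mathcal{D}_t = \{M_0,y_1,M_1,\dots,y_t,M_t\}$, $W\succ 0$ a symmetric positive definite $m\times m$ matrix, $\mu\in\mathbb{R}^n$, and $P\in\mathbb{R}^{n\times n}$ symmetric positive semidefinite. Let $V_t = \sum_{k=0}^{t-1} M_k^\top W M_k$ and, whenever $P+V_t\succ 0$, let $\hat\theta_t$ be the unique minimizer of $\|\theta-\mu\|_P^2 + \sum_{k=0}^{t-1}\|y_{k+1}-M_k\theta\|_W^2$. Assume (i) for a known $c_w>0$ and all $t\in\mathbb{N}_{\le T-1}$, $\mathbb{E}[e^{\nu^\top w_t}\mid\mathcal{D}_t] \le e^{\frac12 c_w^2\nu^\top W^{-1}\nu}$ for all $\nu\in\mathbb{R}^m$; and (ii) for a known $c_\theta\ge0$, $\|\theta^\star-\mu\|_P\le c_\theta$. Let $\bar V\in\mathbb{R}^{n\times n}$ be any symmetric positive definite matrix, $\delta\in(0,1)$, and define $$\beta_t = \sqrt{1+\rho(V_t^{-1}\bar V)}\,\sqrt{c_\theta^2 +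 c_w^2\log\left|I_n+\bar V^{-1}V_t\right| + 2c_w^2\log(1/\delta)}$$ when $V_t$ is invertible, and $\beta_t=+\infty$ when $V_t$ is not invertible. Then $$\mathbb{P}\left[\|\theta^\star-\hat\theta_t\|_{P+V_t}\le\beta_t,\ \forall t\in\mathbb{N}_{\le T}\right]\ge 1-\delta,$$ where the inequality is regarded as trivially satisfied at times with $\beta_t=+\infty$.
   Context: For a symmetric positive definite $A$, $\|x\|_A^2 = x^\top A x$ (for $A\succeq0$, $\|x\|_A = \sqrt{x^\top A x}$); $|A|$ denotes the determinant and $\rho(A)$ the spectral radius of a square matrix $A$. The probability is over the data-generation process; $\theta^\star$ is deterministic. *)

(* Defs.v *)
From HB Require Import structures.
From mathcomp Require Import all_boot all_order all_algebra.
From mathcomp Require Import all_classical all_reals all_analysis measurable_realfun.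
From mathcomp.real_closed Require Import complex.
Set Implicit Arguments. Unset Strict Implicit. Unset Printing Implicit Defensive.
Import Order.TTheory GRing.Theory Num.Theory.
Local Open Scope classical_set_scope.
Local Open Scope ring_scope.

Definition qform (R : realType) (n : nat) (A : 'M[R]_n) (x : 'cV[R]_n) : R :=
  (x^T *m A *m x) 0 0.

Definition wnorm (R : realType) (n : nat) (A : 'M[R]_n) (x : 'cV[R]_n) : R :=
  Num.sqrt (qform A x).

Definition sym_posdef (R : realType) (n : nat) (A : 'M[R]_n) : Prop :=
  A^T = A /\ forall x : 'cV[R]_n, x != 0 -> 0 < qform A x.

Definition sym_psd (R : realType) (n : nat) (A : 'M[R]_n) : Prop :=
  A^T = A /\ forall x : 'cV[R]_n, 0 <= qform A x.

Definition eigenvalueC (R : realType) (n : nat) (A : 'M[R]_n) (l : R[i]) : Prop :=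
  \det (map_mx (fun x : R => x%:C%C) A - l%:M) = 0.

Definition modC (R : realType) (z : R[i]) : R :=
  Num.sqrt (complex.Re z ^+ 2 + complex.Im z ^+ 2).

Definition spectral_radius (R : realType) (n : nat) (A : 'M[R]_n) : R :=
  sup [set modC l | l in [set l | eigenvalueC A l]].

Definition Vt (R : realType) (m n : nat) (M : nat -> 'M[R]_(m, n)) (W : 'M[R]_m)
  (t : nat) : 'M[R]_n := \sum_(k < t) (M k)^T *m W *m M k.

Definition rls_cost (R : realType) (m n : nat) (P : 'M[R]_n) (mu : 'cV[R]_n)
  (W : 'M[R]_m) (M : nat -> 'M[R]_(m, n)) (y : nat -> 'cV[R]_m) (t : nat)
  (th : 'cV[R]_n) : R :=
  qform P (th - mu) + \sum_(k < t) qform W (y k.+1 - M k *m th).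

(* beta_t when V_t is invertible *)
Definition beta (R : realType) (n : nat) (V Vbar : 'M[R]_n) (cth cw delta : R) : R :=
  Num.sqrt (1 + spectral_radius (invmx V *m Vbar)) *
  Num.sqrt (cth ^+ 2 + cw ^+ 2 * ln (\det (1%:M + invmx Vbar *m V))
            + 2 * cw ^+ 2 * ln (delta^-1)).

(* time horizons: None stands for T = +oo *)
Definition le_T (Tm : option nat) (t : nat) : bool :=
  if Tm is Some T then (t <= T)%N else true.
Definition le_Tm1 (Tm : option nat) (t : nat) : bool :=
  if Tm is Some T then (t < T)%N else true.

Definition data_gen d (T : measurableType d) (R : realType) (m n : nat)
  (M : nat -> T -> 'M[R]_(m, n)) (y : nat -> T -> 'cV[R]_m) (t : nat)
  : set (set T) :=
  [set A | exists (k : nat) (B : set R), measurable B /\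
     ((exists (i : 'I_m) (j : 'I_n), (k <= t)%N /\ A = (fun w => M k w i j) @^-1` B)
   \/ (exists i : 'I_m, (1 <= k <= t)%N /\ A = (fun w => y k w i 0) @^-1` B))].

Definition data_sigma d (T : measurableType d) (R : realType) (m n : nat)
  (M : nat -> T -> 'M[R]_(m, n)) (y : nat -> T -> 'cV[R]_m) (t : nat)
  : set (set T) := <<s data_gen M y t >>.

Definition cond_exp_le d (T : measurableType d) (R : realType)
  (P : probability T R) (G : set (set T)) (X : T -> R) (c : R) : Prop :=
  exists Z : T -> \bar R,
    (forall B : set (\bar R), (measurable : set (set (\bar R))) B -> G (Z @^-1` B)) /\
    (forall A, G A -> (\int[P]_(x in A) Z x = \int[P]_(x in A) (X x)%:E)%E) /\
    {ae P, forall x, (Z x <= c%:E)%E}.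

(* Main.v *)
Require Import Defs.
From HB Require Import structures.
From mathcomp Require Import all_boot all_order all_algebra.
From mathcomp Require Import all_classical all_reals all_analysis measurable_realfun.
From mathcomp.real_closed Require Import complex.
From mathcomp Require Import ring lra.
Import Order.TTheory GRing.Theory Num.Theory.
Import numFieldNormedType.Exports.
Local Open Scope classical_set_scope.
Local Open Scope ring_scope.
Set Implicit Arguments. Unset Strict Implicit. Unset Printing Implicit Defensive.

(** Put S_t = cw^-1 sum_{k<t} M_k^T W w_k. For each fixed lam, the process
    exp (lam^T S_t - lam^T V_t lam / 2) is a nonnegative supermartingale;
    integrating it against the Gaussian weight exp (- lam^T Vbar lam / 2) gives
    the supermartingale
      |Vbar + V_t|^(-1/2) exp (S_t^T (Vbar + V_t)^-1 S_t / 2),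
    to which Ville's maximal inequality applies. On the resulting event,
    e = theta - th_hat solves (P + V_t) e = P (theta - mu) - cw S_t; two
    applications of Young's inequality together with
    Vbar + V_t <= (1 + rho (V_t^-1 Vbar)) V_t bound the norm of e by beta_t.

    The n-dimensional Gaussian integral is never formed: one coordinate at a
    time is integrated out by Tonelli, which replaces the quadratic form by its
    Schur complement with respect to the first coordinate. *)

(** * Quadratic forms and generalized eigenvalues *)

(** The noise bound is given for each fixed [nu], with an exceptional null set that may depend on
    [nu], whereas the direction needed at time t, cw^-1 W M_t lam, is random. Conditional
    expectations therefore enter only through integrals over sets of [data_sigma], and the
    supermartingale property is an inequality between such integrals. The inequality for the mixture
    then follows by integrating in lam the inequalities for fixed lam, and the maximal inequality
    asks for it only on the events that the level has not yet been reached.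

    The other obstacle is that the confidence event must be shown measurable, although it quantifies
    over all minimizers and contains a supremum over complex eigenvalues. The minimizers are
    replaced by the explicit solution of the normal equations. For positive definite V and U, the
    spectral radius of V^-1 U is the least c >= 0 with U <= c V: this gives both the matrix
    inequality behind the bound and a condition that can be tested on countably many integer
    vectors. *)

Section Bilinear.
Context {R : realType} {n : nat}.
Implicit Types (A B : 'M[R]_n) (x y : 'cV[R]_n).

Definition bform A x y : R := (x^T *m A *m y) 0 0.

Lemma qformE A x : qform A x = bform A x x. Proof. by []. Qed.

Lemma bformDl A x x' y : bform A (x + x') y = bform A x y + bform A x' y.
Proof. by rewrite /bform linearD/= !mulmxDl mxE. Qed.

Lemma bformDr A x y y' : bform A x (y + y') = bform A x y + bform A x y'.
Proof. by rewrite /bform mulmxDr mxE. Qed.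

Lemma bformZl A k x y : bform A (k *: x) y = k * bform A x y.
Proof. by rewrite /bform linearZ/= -!scalemxAl mxE. Qed.

Lemma bformZr A k x y : bform A x (k *: y) = k * bform A x y.
Proof. by rewrite /bform -scalemxAr mxE. Qed.

Lemma bformC A x y : A^T = A -> bform A x y = bform A y x.
Proof.
move=> At; rewrite /bform.
by rewrite -[in LHS](trmxK (x^T *m A *m y)) mxE !trmx_mul trmxK At mulmxA.
Qed.

Lemma bform_add A B x y : bform (A + B) x y = bform A x y + bform B x y.
Proof. by rewrite /bform mulmxDr mulmxDl mxE. Qed.

Lemma bform_scale A k x y : bform (k *: A) x y = k * bform A x y.
Proof. by rewrite /bform -scalemxAr -scalemxAl mxE. Qed.

Lemma bform0l A x : bform A 0 x = 0.
Proof. by rewrite /bform trmx0 !mul0mx mxE. Qed.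

Lemma bform_delta A i x : bform A (delta_mx i 0) x = (A *m x) i 0.
Proof. by rewrite /bform trmx_delta -mulmxA -rowE mxE. Qed.

Lemma qform_add A x y : A^T = A ->
  qform A (x + y) = qform A x + 2 * bform A x y + qform A y.
Proof.
move=> At; rewrite !qformE bformDl !bformDr (bformC y x At); ring.
Qed.

Lemma qform_sum A x : qform A x = \sum_i \sum_j A i j * (x i 0 * x j 0).
Proof.
rewrite /qform -mulmxA mxE; apply: eq_bigr => i _.
by rewrite !mxE mulr_sumr; apply: eq_bigr => j _; ring.
Qed.

Lemma sym_posdef_psd A : sym_posdef A -> sym_psd A.
Proof.
move=> [At Ap]; split=> // x; have [->|x0] := eqVneq x 0.
  by rewrite qformE bform0l.
exact/ltW/Ap.
Qed.

(** Expand the nonnegative value of the form at [k *: x - y] and divide by [k]. *)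
Lemma psd_young A k x y : sym_psd A -> 0 < k ->
  2 * bform A x y <= k * qform A x + k^-1 * qform A y.
Proof.
move=> [At Ap] k0; have := Ap (k *: x + (-1) *: y).
rewrite qform_add// !qformE !bformZl !bformZr => h.
have k1 : k^-1 * k = 1 by rewrite mulVf// gt_eqF.
have := mulr_ge0 (ltW (_ : 0 < k^-1)) h; rewrite invr_gt0 => /(_ k0).
suff -> : k^-1 * (k * (k * bform A x x) + 2 * (k * (-1 * bform A x y)) +
  -1 * (-1 * bform A y y)) = (k^-1 * k) * (k * bform A x x - 2 * bform A x y) +
  k^-1 * bform A y y by rewrite k1; lra.
by ring.
Qed.

Lemma psd_cauchy_schwarz A x y : sym_psd A ->
  bform A x y ^+ 2 <= qform A x * qform A y.
Proof.
move=> [At Ap].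
have h t : 0 <= qform A x + 2 * t * bform A x y + t ^+ 2 * qform A y.
  have := Ap (x + t *: y); rewrite qform_add// !qformE !bformZl !bformZr.
  by rewrite expr2 !mulrA.
have y0 := Ap y; have := h.
move: (bform A x y) (qform A x) (qform A y) y0 => b p q q0 {}h.
have [q0'|q0'] := eqVneq q 0.
  suff -> : b = 0 by rewrite expr0n/= q0' mulr0.
  apply/eqP; apply: contraT => b0.
  (* With [q = 0] the polynomial is affine in its argument; at this point it equals -1. *)
  have := h (- (p + 1) / (2 * b)); rewrite q0' mulr0 addr0.
  have -> : 2 * (- (p + 1) / (2 * b)) * b = - (p + 1) by field.
  lra.
have qp : 0 < q by rewrite lt_neqAle eq_sym q0'.
(* The vertex of the parabola. *)
have := mulr_ge0 q0 (h (- b / q)).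
have -> : q * (p + 2 * (- b / q) * b + (- b / q) ^+ 2 * q) = p * q - b ^+ 2.
  by field.
lra.
Qed.

Lemma psd_ker A x : sym_psd A -> qform A x = 0 -> A *m x = 0.
Proof.
move=> Ap qx; apply/matrixP => i j; rewrite ord1 [RHS]mxE.
have := psd_cauchy_schwarz (delta_mx i 0) x Ap.
rewrite qx mulr0 bform_delta => h; apply/eqP.
by rewrite -sqrf_eq0 eq_le h sqr_ge0.
Qed.

Lemma posdef_unit A : sym_posdef A -> A \in unitmx.
Proof.
move=> [At Ap]; rewrite unitmxE unitfE; apply/negP => /det0P[v v0 vA].
have := Ap v^T; rewrite trmx_eq0 v0 => /(_ isT).
by rewrite /qform trmxK vA mul0mx mxE ltxx.
Qed.

(** By Cauchy-Schwarz, a vector on which a semidefinite form vanishes lies in the kernel. *)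
Lemma psd_unit_posdef A : sym_psd A -> A \in unitmx -> sym_posdef A.
Proof.
move=> [At Ap] uA; split=> // x x0; rewrite lt_neqAle Ap andbT.
apply/eqP => /esym/(psd_ker (conj At Ap)) Ax0; move/eqP: x0; apply.
by rewrite -(mulKmx uA x) Ax0 mulmx0.
Qed.

Lemma bform_invl A x y : A^T = A -> A \in unitmx ->
  bform A (invmx A *m x) y = (x^T *m y) 0 0.
Proof.
by move=> At uA; rewrite /bform trmx_mul trmx_inv At mulmxKV.
Qed.

Lemma qform_inv A x : A^T = A -> A \in unitmx ->
  qform A (invmx A *m x) = qform (invmx A) x.
Proof. by move=> At uA; rewrite qformE bform_invl// mulmxA. Qed.

(** The coordinate [x i 0] is the [B]-product of [x] with [invmx B *m delta_mx i 0], so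
    Cauchy-Schwarz applies. *)
Lemma coord_bound B i x : sym_posdef B ->
  x i 0 ^+ 2 <= qform B (invmx B *m delta_mx i 0) * qform B x.
Proof.
move=> Bp; have uB := posdef_unit Bp.
have := psd_cauchy_schwarz (invmx B *m delta_mx i 0) x (sym_posdef_psd Bp).
rewrite bform_invl//; last by case: Bp.
by rewrite trmx_delta -rowE mxE.
Qed.

(** Takes the place of compactness of the unit sphere: coordinates are controlled by [coord_bound],
    and the constant sums the entries of [A] against these bounds. The extra 1 makes it positive. *)
Lemma posdef_dominates A B : sym_posdef B ->
  exists2 K, 0 < K & forall x, qform A x <= K * qform B x.
Proof.
move=> Bp; pose c i := qform B (invmx B *m delta_mx i 0).
have B0 x := (sym_posdef_psd Bp).2 x.
have c0 i : 0 <= c i by exact: B0.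
exists (1 + \sum_i \sum_j `|A i j| * (c i + c j)) => [|x].
  apply: ltr_pwDl => //; apply: sumr_ge0 => i _; apply: sumr_ge0 => j _.
  by rewrite mulr_ge0// addr_ge0.
rewrite mulrDl mul1r ler_wpDl// qform_sum mulr_suml; apply: ler_sum => i _.
rewrite mulr_suml; apply: ler_sum => j _.
apply: (le_trans (ler_norm _)); rewrite normrM -mulrA ler_wpM2l//.
have hi := coord_bound i x Bp; have hj := coord_bound j x Bp.
rewrite -/(c i) in hi; rewrite -/(c j) in hj; rewrite mulrDl.
have := sqr_ge0 (x i 0 - x j 0); have := sqr_ge0 (x i 0 + x j 0).
by rewrite ler_norml !expr2 in hi hj * => h1 h2; apply/andP; split; nra.
Qed.

End Bilinear.

Section GeneralizedEigenvalues.
Context {R : realType} {n : nat} {V U : 'M[R]_n}.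
Hypotheses (Vp : sym_posdef V) (Up : sym_posdef U).
Let uV := posdef_unit Vp.

(** Eigenvalues of [invmx V *m U] are real and are Rayleigh quotients: the real and imaginary parts
    of a complex eigenvector satisfy a coupled real system, and symmetry of [U] and [V] forces the
    imaginary part of [l] to vanish. *)
Lemma eigenvalueC_real (l : R[i]) : eigenvalueC (invmx V *m U) l ->
  exists x : 'cV[R]_n, [/\ x != 0 & modC l * qform V x = qform U x].
Proof.
rewrite /eigenvalueC => /eqP/det0P[v v0 vE].
(* Substituting [u = v V^-1] turns the left eigenvector into a solution of the generalized problem
   [u U = l u V], in which both matrices are symmetric. *)
pose u := v *m map_mx (real_complex R) (invmx V).
have uVE : u *m map_mx (real_complex R) V = v.
  by rewrite /u -mulmxA -map_mxM mulVmx// map_mx1 mulmx1.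
have uUE : u *m map_mx (real_complex R) U = l *: (u *m map_mx (real_complex R) V).
  apply/eqP; rewrite uVE -subr_eq0 /u -mulmxA -map_mxM -mul_mx_scalar.
  by rewrite -mulmxBr; apply/eqP.
move: u uVE uUE => u uVE uUE.
pose x := map_mx (@complex.Re R) u; pose y := map_mx (@complex.Im R) u.
have ReM A : map_mx (@complex.Re R) (u *m map_mx (real_complex R) A) = x *m A.
  apply/matrixP => i j; rewrite !mxE raddf_sum/=; apply: eq_bigr => k _.
  by rewrite !mxE; case: (u i k) => p q /=; ring.
have ImM A : map_mx (@complex.Im R) (u *m map_mx (real_complex R) A) = y *m A.
  apply/matrixP => i j; rewrite !mxE raddf_sum/=; apply: eq_bigr => k _.
  by rewrite !mxE; case: (u i k) => p q /=; ring.
case: l uUE {vE} => al be uUE.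
have xU : x *m U = al *: (x *m V) - be *: (y *m V).
  rewrite -!ReM -ImM uUE; apply/matrixP => i j; rewrite !mxE.
  by case: (\sum_j0 _).
have yU : y *m U = al *: (y *m V) + be *: (x *m V).
  rewrite -!ImM -ReM uUE; apply/matrixP => i j; rewrite !mxE.
  by case: (\sum_j0 _).
have bU A z t : bform A z^T t^T = (z *m A *m t^T) 0 0 by rewrite /bform trmxK.
have xyN0 : (x != 0) || (y != 0).
  rewrite -negb_and; apply: contra v0 => /andP[/eqP x0 /eqP y0].
  suff u0 : u = 0 by rewrite -uVE u0 mul0mx.
  apply/matrixP => i j; move/matrixP: x0 => /(_ i j); move/matrixP: y0 => /(_ i j).
  by rewrite !mxE; case: (u i j) => p q /= -> ->.
have V0 z := (sym_posdef_psd Vp).2 z.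
have qV0 : 0 < qform V x^T + qform V y^T.
  case/orP: xyN0 => z0; [apply: ltr_pwDl|apply: ltr_wpDl] => //;
  by apply: Vp.2; rewrite trmx_eq0.
have be0 : be = 0.
  have h1 : bform U x^T y^T = al * bform V x^T y^T - be * qform V y^T.
    rewrite qformE !bU xU mulmxBl -!scalemxAl.
    by rewrite mxE [X in _ + X]mxE [X in X + _]mxE [X in _ - X]mxE.
  have h2 : bform U y^T x^T = al * bform V y^T x^T + be * qform V x^T.
    by rewrite qformE !bU yU mulmxDl -!scalemxAl mxE [X in _ + X]mxE [X in X + _]mxE.
  (* The form of [U] at [(x, y)] and at [(y, x)] agree; subtracting the two expressions leaves only
     the terms in [be]. *)
  have : be * (qform V x^T + qform V y^T) = 0.
    have := h1; rewrite (bformC _ _ Up.1) h2 (bformC _ _ Vp.1); lra.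
  by move/eqP; rewrite mulf_eq0 (gt_eqF qV0) orbF => /eqP.
have [z z0 zU] : exists2 z : 'rV[R]_n, z != 0 & z *m U = al *: (z *m V).
  case/orP: xyN0 => z0; [exists x|exists y] => //.
    by rewrite xU be0 scale0r subr0.
  by rewrite yU be0 scale0r addr0.
have z0T : z^T != 0 by rewrite trmx_eq0.
have qz : qform U z^T = al * qform V z^T.
  by rewrite !qformE !bU zU -scalemxAl mxE.
exists z^T; split=> //.
rewrite be0 /modC/= expr0n/= addr0 sqrtr_sqr ger0_norm ?qz//.
by rewrite -(pmulr_lge0 _ (Vp.2 _ z0T)) -qz ltW// Up.2.
Qed.

Lemma real_eigenvalue (s : R) : s *: V - U \notin unitmx ->
  eigenvalueC (invmx V *m U) (s%:C)%C.
Proof.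
rewrite unitmxE unitfE negbK => /eqP sVU.
rewrite /eigenvalueC -[X in _ - X](map_scalar_mx (real_complex R)) -map_mxB det_map_mx.
have -> : invmx V *m U - s%:M = - (invmx V *m (s *: V - U)).
  by rewrite mulmxBr -scalemxAr mulVmx// scalemx1 opprB.
by rewrite -scaleN1r detZ det_mulmx sVU !mulr0 rmorph0.
Qed.

Lemma spectral_radius_le c : 0 <= c -> (forall x, qform U x <= c * qform V x) ->
  spectral_radius (invmx V *m U) <= c.
Proof.
move=> c0 Uc; rewrite /spectral_radius.
(* There is no eigenvalue when [n = 0]; the supremum is then 0 and [0 <= c] concludes. *)
have [->|/set0P ne] := eqVneq [set modC l | l in [set l | eigenvalueC (invmx V *m U) l]] set0.
  by rewrite sup0.
apply: ge_sup => // _ [l /eigenvalueC_real[x [x0 lx]] <-].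
by rewrite -(ler_pM2r (Vp.2 _ x0)) lx.
Qed.

Lemma spectral_radius_ge0 : 0 <= spectral_radius (invmx V *m U).
Proof.
rewrite /spectral_radius; set S := [set _ | _ in _].
have [[[r Sr] uS]|/sup_out->//] := pselect (has_sup S).
apply: (le_trans _ (ub_le_sup uS Sr)); case: Sr => l _ <-.
exact: sqrtr_ge0.
Qed.

(** Let [s] be the infimum of the constants [c] with U <= c V; it is itself such a constant. If
    [s *: V - U] were invertible it would be positive definite, hence would dominate a multiple of
    [V], and [s] could be lowered. So it is singular and [s] is an eigenvalue. *)
Lemma qform_le_spectral_radius x :
  qform U x <= spectral_radius (invmx V *m U) * qform V x.
Proof.
have [->|x0] := eqVneq x 0; first by rewrite !qformE !bform0l mulr0.
have V0 z := (sym_posdef_psd Vp).2 z.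
pose S := [set s | forall z, qform U z <= s * qform V z].
have Sinf : has_inf S.
  split; first by have [K _ KU] := posdef_dominates U Vp; exists K.
  by exists (qform U x / qform V x) => s Ss; rewrite ler_pdivrMr ?Vp.2.
pose s := inf S.
have Ss z : qform U z <= s * qform V z.
  have [->|z0] := eqVneq z 0; first by rewrite !qformE !bform0l mulr0.
  rewrite -ler_pdivrMr ?Vp.2//; apply: lb_le_inf; first by case: Sinf.
  by move=> r Sr; rewrite ler_pdivrMr ?Vp.2.
have psdS : sym_psd (s *: V - U).
  split=> [|z]; first by rewrite linearB linearZ/= Vp.1 Up.1.
  by rewrite qformE -scaleN1r bform_add !bform_scale mulN1r subr_ge0; exact: Ss.
have nuS : s *: V - U \notin unitmx.
  apply/negP => /(psd_unit_posdef psdS)/(posdef_dominates V)[K K0 VK].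
  suff : S (s - K^-1) by move=> /(ge_inf Sinf.2); rewrite -/s lerBrDl gerDr leNgt invr_gt0 K0.
  move=> z; have := VK z.
  rewrite !qformE -scaleN1r bform_add !bform_scale mulN1r mulrBl -ler_pdivrMl//.
  lra.
apply: (le_trans (Ss x)); rewrite ler_wpM2r//.
have modCs : s <= modC (s%:C)%C by rewrite /modC/= expr0n/= addr0 sqrtr_sqr ler_norm.
apply: (le_trans modCs); apply: ub_le_sup; last first.
  by exists (s%:C)%C => //; exact: real_eigenvalue.
(* The supremum bounds its elements only if the set is bounded, which domination of [U] by [V]
   provides. *)
have [K K0 UK] := posdef_dominates U Vp.
exists K => _ [l /eigenvalueC_real[z [z0 lz]] <-].
by rewrite -(ler_pM2r (Vp.2 _ z0)) lz.
Qed.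

End GeneralizedEigenvalues.

(** * Measurable matrices and Schur complements *)

Section MatrixMeasurability.
Context {d : measure_display} {T : measurableType d} {R : realType}.

Definition mx_measurable p q (f : T -> 'M[R]_(p, q)) :=
  forall i j, measurable_fun setT (fun x => f x i j).

(** Inversion is written as f times the power -1 of f^2: the real power is applied to a nonnegative
    number, the factor f restores the sign, and both sides are 0 where f vanishes. *)
Lemma measurable_funV (f : T -> R) :
  measurable_fun setT f -> measurable_fun setT (fun x => (f x)^-1).
Proof.
move=> mf.
have -> : (fun x => (f x)^-1) = (fun x => f x * (f x ^+ 2) `^ (-1)).
  apply/funext => x; rewrite powR_inv1 ?sqr_ge0//.
  have [->|fx0] := eqVneq (f x) 0; first by rewrite invr0 mul0r.
  by rewrite expr2 invfM mulrA divff// mul1r.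
apply: measurable_funM => //.
exact: (measurableT_comp (measurable_powR _)) (measurable_funX _ mf).
Qed.

Lemma measurable_fun_sqrt (f : T -> R) :
  measurable_fun setT f -> measurable_fun setT (fun x => Num.sqrt (f x)).
Proof.
move=> mf; apply: (measurableT_comp _ mf).
by apply: continuous_measurable_fun; exact: sqrt_continuous.
Qed.

Lemma mx_measurable_cst p q (A : 'M[R]_(p, q)) : mx_measurable (fun=> A).
Proof. by move=> i j; exact: measurable_cst. Qed.

Lemma mx_measurableD p q (f g : T -> 'M[R]_(p, q)) :
  mx_measurable f -> mx_measurable g -> mx_measurable (fun x => f x + g x).
Proof.
move=> mf mg i j; under eq_fun do rewrite mxE.
exact: measurable_funD.
Qed.

Lemma mx_measurableZ p q (k : T -> R) (f : T -> 'M[R]_(p, q)) :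
  measurable_fun setT k -> mx_measurable f -> mx_measurable (fun x => k x *: f x).
Proof.
move=> mk mf i j; under eq_fun do rewrite mxE.
exact: measurable_funM.
Qed.

Lemma mx_measurableB p q (f g : T -> 'M[R]_(p, q)) :
  mx_measurable f -> mx_measurable g -> mx_measurable (fun x => f x - g x).
Proof.
move=> mf mg i j; under eq_fun do rewrite !mxE.
exact: measurable_funB.
Qed.

Lemma mx_measurable_sum p q (I : Type) (r : seq I) (f : I -> T -> 'M[R]_(p, q)) :
  (forall k, mx_measurable (f k)) -> mx_measurable (fun x => \sum_(k <- r) f k x).
Proof.
move=> mf i j; under eq_fun do rewrite summxE.
by apply: measurable_sum => k; exact: mf.
Qed.

Lemma mx_measurableM p q r (f : T -> 'M[R]_(p, q)) (g : T -> 'M[R]_(q, r)) :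
  mx_measurable f -> mx_measurable g -> mx_measurable (fun x => f x *m g x).
Proof.
move=> mf mg i j; under eq_fun do rewrite mxE.
by apply: measurable_sum => k; exact: measurable_funM.
Qed.

Lemma mx_measurable_tr p q (f : T -> 'M[R]_(p, q)) :
  mx_measurable f -> mx_measurable (fun x => (f x)^T).
Proof. by move=> mf i j; under eq_fun do rewrite mxE; exact: mf. Qed.

Lemma measurable_det p (f : T -> 'M[R]_p) :
  mx_measurable f -> measurable_fun setT (fun x => \det (f x)).
Proof.
move=> mf; rewrite /determinant; apply: measurable_sum => s.
apply: measurable_funM => //.
by apply: measurable_prod => i _; exact: mf.
Qed.

Lemma measurable_unitmx p (f : T -> 'M[R]_p) :
  mx_measurable f -> measurable_fun setT (fun x => f x \in unitmx).
Proof.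
move=> mf; under eq_fun do rewrite unitmxE unitfE.
apply: measurable_neg; apply: measurable_fun_eqr => //.
exact: measurable_det.
Qed.

Lemma mx_measurable_inv p (f : T -> 'M[R]_p) :
  mx_measurable f -> mx_measurable (fun x => invmx (f x)).
Proof.
move=> mf i j.
(* [invmx] returns its argument on a singular matrix, whence the second branch. *)
rewrite (_ : (fun x => _) = (fun x => if f x \in unitmx
    then (\det (f x))^-1 * cofactor (f x) j i else f x i j)); last first.
  by apply/funext => x; rewrite /invmx; case: ifP => // _; rewrite !mxE.
apply: measurable_fun_ifT => //; first exact: measurable_unitmx.
apply: measurable_funM; first exact/measurable_funV/measurable_det.
apply: measurable_funM => //; apply: measurable_det => k l.
by under eq_fun do rewrite !mxE; exact: mf.
Qed.

Lemma measurable_qform p (A : T -> 'M[R]_p) (u : T -> 'cV[R]_p) :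
  mx_measurable A -> mx_measurable u ->
  measurable_fun setT (fun x => qform (A x) (u x)).
Proof.
move=> mA mu; rewrite /qform; apply: (mx_measurableM _ mu).
exact: mx_measurableM (mx_measurable_tr mu) mA.
Qed.

End MatrixMeasurability.

(** * Elimination of the first coordinate from a quadratic form *)

Section Schur.
Context {R : realType} {n : nat}.
Implicit Types (A : 'M[R]_(1 + n)) (S : 'cV[R]_(1 + n)).

Definition pivot A : R := ulsubmx A 0 0.
Definition schur A : 'M[R]_n :=
  drsubmx A - (pivot A)^-1 *: (dlsubmx A *m (dlsubmx A)^T).
(** The right-hand side left when the first unknown is eliminated from [A *m x = S]. *)
Definition schur_vec A S : 'cV[R]_n :=
  dsubmx S - ((pivot A)^-1 * usubmx S 0 0) *: dlsubmx A.

Lemma sym_block A : A^T = A ->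
  A = block_mx (pivot A)%:M (dlsubmx A)^T (dlsubmx A) (drsubmx A).
Proof.
move=> At; rewrite -[LHS]submxK; congr (block_mx _ _ _ _).
  by rewrite [LHS]mx11_scalar.
by rewrite trmx_dlsub At.
Qed.

Lemma dotmxC m (u v : 'cV[R]_m) : (u^T *m v) 0 0 = (v^T *m u) 0 0.
Proof. by rewrite -[in LHS](trmxK (u^T *m v)) mxE trmx_mul trmxK. Qed.

Lemma qform_block A (l : R) (x : 'cV[R]_n) : A^T = A ->
  qform A (col_mx l%:M x) = pivot A * l ^+ 2 + 2 * l * ((dlsubmx A)^T *m x) 0 0
    + qform (drsubmx A) x.
Proof.
move=> At; rewrite /qform [in LHS](sym_block At).
rewrite tr_col_mx mul_row_block mul_row_col tr_scalar_mx.
rewrite !mulmxDl !mul_scalar_mx scale_scalar_mx mul_mx_scalar -!scalemxAl.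
rewrite mul_mx_scalar [LHS]mxE [X in X + _]mxE [X in _ + X]mxE.
rewrite mxE [X in _ + X + _]mxE [X in _ + (X + _)]mxE (dotmxC x) mxE eqxx mulr1n.
ring.
Qed.

Lemma pivot_gt0 A : sym_posdef A -> 0 < pivot A.
Proof.
move=> [At Ap]; have := Ap (col_mx 1%:M 0).
rewrite qform_block// mulmx0 qformE bform0l mxE.
have -> : col_mx 1%:M 0 != 0 :> 'cV[R]_(1 + n).
  apply/eqP => /matrixP/(_ (lshift n 0) 0)/eqP.
  by rewrite col_mxEu !mxE eqxx mulr1n oner_eq0.
by move=> /(_ isT); rewrite expr1n; lra.
Qed.

Lemma qform_schur A x : qform (schur A) x =
  qform (drsubmx A) x - (pivot A)^-1 * ((dlsubmx A)^T *m x) 0 0 ^+ 2.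
Proof.
rewrite qformE /schur -scaleN1r scalerA bform_add bform_scale.
congr (_ + _); rewrite -mulrA mulN1r; congr (- (_ * _)).
rewrite /bform mulmxA -mulmxA mxE big_ord1 expr2; congr (_ * _).
exact: dotmxC.
Qed.

(** The form of [schur A] at [x] is the minimum of the form of [A] over vectors whose last
    coordinates are [x], attained at first coordinate [- be / pivot A]. *)
Lemma posdef_schur A : sym_posdef A -> sym_posdef (schur A).
Proof.
move=> Ap; have a0 := pivot_gt0 Ap; split=> [|x x0].
  by rewrite /schur linearB linearZ/= trmx_mul trmxK trmx_drsub Ap.1.
pose be := ((dlsubmx A)^T *m x) 0 0.
have := Ap.2 (col_mx (- be / pivot A)%:M x); rewrite qform_block ?Ap.1// -/be.
rewrite qform_schur -/be => h; rewrite (lt_le_trans (h _))//; last first.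
  rewrite le_eqVlt; apply/orP; left; apply/eqP; field.
  by rewrite gt_eqF.
by apply: contra_neq x0 => /(congr1 dsubmx); rewrite col_mxKd linear0.
Qed.

Lemma det_schur A : sym_posdef A -> \det A = pivot A * \det (schur A).
Proof.
move=> Ap; have a0 := pivot_gt0 Ap.
(* Block LU factorization; the left factor has determinant 1. *)
have AE : A = block_mx 1%:M 0 ((pivot A)^-1 *: dlsubmx A) 1%:M *m
    block_mx (pivot A)%:M (dlsubmx A)^T 0 (schur A).
  rewrite mulmx_block !mul1mx !mul0mx !addr0 mul_mx_scalar scalerA divff ?gt_eqF//.
  rewrite scale1r -scalemxAl /schur [X in block_mx _ _ _ X]addrC subrK.
  exact/sym_block/Ap.1.
by rewrite {1}AE det_mulmx det_lblock det_ublock !det1 !mul1r det_scalar1.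
Qed.

(** Solve [A *m x = S] by elimination: the tail [z] of [x] solves the Schur system with right-hand
    side [schur_vec A S], the head follows from the first row, and the left side is the product of
    [S] with [x]. *)
Lemma qform_inv_schur A S : sym_posdef A -> qform (invmx A) S =
  (pivot A)^-1 * usubmx S 0 0 ^+ 2 + qform (invmx (schur A)) (schur_vec A S).
Proof.
move=> Ap; have a0 := pivot_gt0 Ap; have uA := posdef_unit Ap.
have Sp := posdef_schur Ap; have uS := posdef_unit Sp.
pose x := invmx A *m S; pose l := usubmx x 0 0; pose z := dsubmx x.
have xE : x = col_mx l%:M z by rewrite -[LHS]vsubmxK [usubmx x]mx11_scalar.
have AxS : A *m x = S by rewrite mulKVmx.
have : block_mx (pivot A)%:M (dlsubmx A)^T (dlsubmx A) (drsubmx A) *m col_mx l%:M z = S.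
  by rewrite -sym_block ?Ap.1// -xE.
rewrite mul_block_col -[RHS]vsubmxK => /eq_col_mx[e1 e2].
have e1' : pivot A * l + ((dlsubmx A)^T *m z) 0 0 = usubmx S 0 0.
  by rewrite -e1 mul_mx_scalar [RHS]mxE [X in _ = X + _]mxE [X in _ = _ * X + _]mxE eqxx mulr1n mulrC.
have zE : schur A *m z = schur_vec A S.
  rewrite /schur_vec -e1' -e2 /schur mulmxBl -scalemxAl -mulmxA.
  rewrite [(_^T *m z)]mx11_scalar mul_mx_scalar [in RHS]mul_mx_scalar.
  rewrite mulrDr mulKf ?gt_eqF// scalerDl scalerA addrAC opprD addrA subrr add0r.
  by rewrite [(_%:M) 0 0]mxE eqxx mulr1n addrC.
have -> : qform (invmx A) S = (S^T *m x) 0 0 by rewrite /qform mulmxA.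
have -> : qform (invmx (schur A)) (schur_vec A S) = ((schur_vec A S)^T *m z) 0 0.
  by rewrite /qform -mulmxA -zE mulKmx.
rewrite xE -[in LHS](vsubmxK S) tr_col_mx mul_row_col mul_mx_scalar.
rewrite mxE [X in X + _]mxE [X in _ * X]mxE.
rewrite /schur_vec linearB linearZ/= mulmxBl -scalemxAl.
rewrite [X in _ = _ + X]mxE [X in _ = _ + (_ + X)]mxE [X in _ = _ + (_ - X)]mxE.
rewrite -e1'; field.
by rewrite gt_eqF.
Qed.

End Schur.

Lemma posdef_det_gt0 {R : realType} n (A : 'M[R]_n) : sym_posdef A -> 0 < \det A.
Proof.
elim: n A => [|n IH] A Ap; first by rewrite det_mx00.
have := @det_schur R n A Ap => ->.
by rewrite mulr_gt0//; [exact: (@pivot_gt0 R n)|exact/IH/(@posdef_schur R n)].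
Qed.

Section SchurMeasurability.
Context {d : measure_display} {T : measurableType d} {R : realType} {n : nat}.
Variables (A : T -> 'M[R]_(1 + n)) (S : T -> 'cV[R]_(1 + n)).
Hypotheses (mA : mx_measurable A) (mS : mx_measurable S).

Lemma measurable_pivot : measurable_fun setT (fun x => pivot (A x)).
Proof. by rewrite /pivot; under eq_fun do rewrite !mxE; exact: mA. Qed.

Let measurable_dl : mx_measurable (fun x => dlsubmx (A x)).
Proof. by move=> i j; under eq_fun do rewrite !mxE; exact: mA. Qed.

Lemma mx_measurable_schur : mx_measurable (fun x => schur (A x)).
Proof.
apply: mx_measurableB; first by move=> i j; under eq_fun do rewrite !mxE; exact: mA.
apply: mx_measurableZ; first exact/measurable_funV/measurable_pivot.
exact: mx_measurableM measurable_dl (mx_measurable_tr measurable_dl).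
Qed.

Lemma mx_measurable_schur_vec : mx_measurable (fun x => schur_vec (A x) (S x)).
Proof.
apply: mx_measurableB; first by move=> i j; under eq_fun do rewrite mxE; exact: mS.
apply: mx_measurableZ => //; apply: measurable_funM.
  exact/measurable_funV/measurable_pivot.
by under eq_fun do rewrite mxE; exact: mS.
Qed.

End SchurMeasurability.

(** * Gaussian mixtures *)

(** After completing the square, the integrand is a constant [k] times the normal density of mean
    [s / a] and variance [a^-1]. *)
Lemma integral_gauss {R : realType} (a s : R) : 0 < a ->
  (\int[@lebesgue_measure R]_l (expR (l * s - 2^-1 * (a * l ^+ 2)))%:E =
   (Num.sqrt (2 * pi) * ((Num.sqrt a)^-1 * expR (2^-1 * (a^-1 * s ^+ 2))))%:E)%E.
Proof.
move=> a0; have sa0 : 0 < Num.sqrt a by rewrite sqrtr_gt0.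
pose sg := (Num.sqrt a)^-1; have sg0 : sg != 0 by rewrite invr_neq0// gt_eqF.
have sg2 : sg ^+ 2 = a^-1 by rewrite exprVn sqr_sqrtr// ltW.
pose k := Num.sqrt (2 * pi) * (sg * expR (2^-1 * (a^-1 * s ^+ 2))).
have k0 : 0 <= k by rewrite !mulr_ge0 ?sqrtr_ge0 ?expR_ge0 ?invr_ge0 ?sqrtr_ge0.
transitivity (\int[lebesgue_measure]_l (k%:E * (normal_pdf (s / a) sg l)%:E))%E.
  apply: eq_integral => l _; rewrite -EFinM normal_pdfE//; congr EFin.
  have -> : normal_peak sg = (Num.sqrt (2 * pi) * sg)^-1.
    rewrite /normal_peak sg2 -mulr_natl mulrCA mulrC sqrtrM; last first.
      by rewrite mulr_ge0// pi_ge0.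
    by rewrite sqrtrV// ltW.
  rewrite /k /normal_fun sg2; set c := Num.sqrt (2 * pi).
  have c0 : c != 0 by rewrite gt_eqF// sqrtr_gt0 mulr_gt0// pi_gt0.
  rewrite (_ : c * (sg * _) * _ = expR (2^-1 * (a^-1 * s ^+ 2)) *
     expR (- (l - s / a) ^+ 2 / (a^-1 *+ 2))); last by field; rewrite sg0.
  rewrite -expRD; congr expR; rewrite -mulr_natr; field.
  by rewrite gt_eqF.
rewrite ge0_integralZl_EFin//.
- by rewrite integral_normal_pdf mule1.
- by move=> l _; rewrite lee_fin normal_pdf_ge0.
- by apply/measurable_EFinP; exact: measurable_normal_pdf.
Qed.

Section GaussianMixture.
Context {R : realType}.

(** With [A] equal to Vbar + V_t, the exponent of the Gaussian weight is already included. *)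
Definition gexp n (A : 'M[R]_n) (S lam : 'cV[R]_n) : R :=
  (lam^T *m S) 0 0 - 2^-1 * qform A lam.

(* Up to the factor (2 pi)^(n/2), the integral over lam of expR (gexp A S lam). *)
Definition gmix n (A : 'M[R]_n) (S : 'cV[R]_n) : R :=
  (Num.sqrt (\det A))^-1 * expR (2^-1 * qform (invmx A) S).

Lemma gmix_ge0 n (A : 'M[R]_n) S : 0 <= gmix A S.
Proof. by rewrite mulr_ge0 ?expR_ge0// invr_ge0 sqrtr_ge0. Qed.

Lemma gexp_col_mx n (A : 'M[R]_(1 + n)) S (l : R) z : A^T = A ->
  gexp A S (col_mx l%:M z) =
  (l * (usubmx S 0 0 - ((dlsubmx A)^T *m z) 0 0) - 2^-1 * (pivot A * l ^+ 2)) +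
  ((z^T *m dsubmx S) 0 0 - 2^-1 * qform (drsubmx A) z).
Proof.
move=> At; rewrite /gexp qform_block// -[in LHS](vsubmxK S) tr_col_mx mul_row_col.
rewrite tr_scalar_mx mul_scalar_mx [X in X - _ = _]mxE [X in X + _ - _ = _]mxE.
by field.
Qed.

(** What is left after integrating out the first coordinate: expanding the square on the right
    yields a constant, a term linear in [z] and a term quadratic in [z], and the last two are
    absorbed by [schur_vec] and [schur]. *)
Lemma gexp_schur n (A : 'M[R]_(1 + n)) S z : 0 < pivot A ->
  2^-1 * ((pivot A)^-1 * usubmx S 0 0 ^+ 2) + gexp (schur A) (schur_vec A S) z =
  2^-1 * ((pivot A)^-1 * (usubmx S 0 0 - ((dlsubmx A)^T *m z) 0 0) ^+ 2) +
  ((z^T *m dsubmx S) 0 0 - 2^-1 * qform (drsubmx A) z).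
Proof.
move=> a0; rewrite /gexp qform_schur.
have -> : (z^T *m schur_vec A S) 0 0 = (z^T *m dsubmx S) 0 0 -
    (pivot A)^-1 * usubmx S 0 0 * ((dlsubmx A)^T *m z) 0 0.
  rewrite /schur_vec mulmxBr -scalemxAr (dotmxC (dlsubmx A)).
  by rewrite mxE [X in _ + X]mxE [X in _ - X]mxE.
field.
by rewrite gt_eqF.
Qed.

(** The contribution of one integrated coordinate, without sqrt (2 pi). *)
Definition schur_factor n (A : 'M[R]_(1 + n)) (S : 'cV[R]_(1 + n)) : R :=
  (Num.sqrt (pivot A))^-1 * expR (2^-1 * ((pivot A)^-1 * usubmx S 0 0 ^+ 2)).

Lemma schur_factor_ge0 n (A : 'M[R]_(1 + n)) S : 0 <= schur_factor A S.
Proof. by rewrite mulr_ge0 ?expR_ge0// invr_ge0 sqrtr_ge0. Qed.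

Lemma gmix_schur n (A : 'M[R]_(1 + n)) S : sym_posdef A -> gmix A S =
  schur_factor A S * gmix (schur A) (schur_vec A S).
Proof.
move=> Ap; rewrite /gmix /schur_factor det_schur// sqrtrM ?ltW ?pivot_gt0// invfM.
rewrite qform_inv_schur// mulrDr expRD; ring.
Qed.

Section Measurability.
Context {d : measure_display} {T : measurableType d}.

Lemma measurable_gexp n (A : T -> 'M[R]_n) (S lam : T -> 'cV[R]_n) :
  mx_measurable A -> mx_measurable S -> mx_measurable lam ->
  measurable_fun setT (fun x => gexp (A x) (S x) (lam x)).
Proof.
move=> mA mS ml; apply: measurable_funB.
  exact: (mx_measurableM (mx_measurable_tr ml) mS).
by apply: measurable_funM => //; exact: measurable_qform.
Qed.

Lemma measurable_gmix n (A : T -> 'M[R]_n) (S : T -> 'cV[R]_n) :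
  mx_measurable A -> mx_measurable S ->
  measurable_fun setT (fun x => gmix (A x) (S x)).
Proof.
move=> mA mS; apply: measurable_funM.
  exact/measurable_funV/measurable_fun_sqrt/measurable_det.
apply: measurableT_comp => //; apply: measurable_funM => //.
by apply: measurable_qform => //; exact: mx_measurable_inv.
Qed.

Lemma measurable_schur_factor n (A : T -> 'M[R]_(1 + n)) (S : T -> 'cV[R]_(1 + n)) :
  mx_measurable A -> mx_measurable S ->
  measurable_fun setT (fun x => schur_factor (A x) (S x)).
Proof.
move=> mA mS; have ma := measurable_pivot mA.
apply: measurable_funM; first exact/measurable_funV/measurable_fun_sqrt.
apply: measurableT_comp => //; apply: measurable_funM => //.
apply: measurable_funM; first exact: measurable_funV.
by apply: measurable_funX; under eq_fun do rewrite mxE; exact: mS.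
Qed.

End Measurability.

Section Comparison.
Context {d : measure_display} {T : measurableType d} (P : probability T R).

Lemma measurable_gauss_integrand n (F : T -> R) (A : T -> 'M[R]_(1 + n))
  (S : T -> 'cV[R]_(1 + n)) (z : 'cV[R]_n) :
  measurable_fun setT F -> mx_measurable A -> mx_measurable S ->
  measurable_fun setT (fun lx : R * T =>
    (F lx.2 * expR (gexp (A lx.2) (S lx.2) (col_mx lx.1%:M z)))%:E).
Proof.
move=> mF mA mS.
have m2 (g : T -> R) : measurable_fun setT g ->
    measurable_fun setT (fun lx : R * T => g lx.2).
  by move=> mg; exact: (measurableT_comp mg measurable_snd).
have mx2 p q (G : T -> 'M[R]_(p, q)) : mx_measurable G ->
    mx_measurable (fun lx : R * T => G lx.2).
  by move=> mG i j; exact: (m2 _ (mG i j)).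
apply/measurable_EFinP; apply: measurable_funM; first exact: (m2 _ mF).
apply: measurableT_comp => //.
apply: measurable_gexp; [exact: mx2 mA|exact: mx2 mS|].
move=> i j; under eq_fun do rewrite mxE.
case: (fintype.split i) => k; last exact: measurable_cst.
under eq_fun do rewrite mxE.
case: (k == j); last exact: measurable_cst.
by under eq_fun do rewrite mulr1n; exact: measurable_fst.
Qed.

(** The weight [F] is arbitrary because each integration multiplies it by [schur_factor], which is
    random; the right side has the same shape in one dimension less. *)
Lemma gauss_step n (F : T -> R) (A : T -> 'M[R]_(1 + n)) (S : T -> 'cV[R]_(1 + n))
  (z : 'cV[R]_n) : (forall x, 0 <= F x) -> (forall x, sym_posdef (A x)) ->
  measurable_fun setT F -> mx_measurable A -> mx_measurable S ->
  (\int[@lebesgue_measure R]_l \int[P]_x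
     (F x * expR (gexp (A x) (S x) (col_mx l%:M z)))%:E =
   (Num.sqrt (2 * pi))%:E * \int[P]_x
     (F x * schur_factor (A x) (S x) *
      expR (gexp (schur (A x)) (schur_vec (A x) (S x)) z))%:E)%E.
Proof.
move=> F0 Ap mF mA mS.
pose c := Num.sqrt (2 * pi) : R.
pose B x := ((dlsubmx (A x))^T *m z) 0 0.
pose Q x := (z^T *m dsubmx (S x)) 0 0 - 2^-1 * qform (drsubmx (A x)) z.
pose f (lx : R * T) : \bar R :=
  (F lx.2 * expR (gexp (A lx.2) (S lx.2) (col_mx lx.1%:M z)))%:E.
have mf : measurable_fun setT f by exact: measurable_gauss_integrand.
have fQ l x : f (l, x) = (F x * expR ((l * (usubmx (S x) 0 0 - B x) -
         2^-1 * (pivot (A x) * l ^+ 2)) + Q x))%:E.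
  by rewrite /f /= gexp_col_mx ?(Ap x).1.
rewrite -[LHS]/(\int[lebesgue_measure]_l \int[P]_x f (l, x))%E.
rewrite fubini_tonelli//; last first.
  by move=> lx; rewrite lee_fin mulr_ge0 ?expR_ge0.
have fE x : (\int[lebesgue_measure]_l f (l, x) =
    c%:E * (F x * schur_factor (A x) (S x) *
      expR (gexp (schur (A x)) (schur_vec (A x) (S x)) z))%:E)%E.
  have a0 := pivot_gt0 (Ap x).
  transitivity (\int[lebesgue_measure]_l ((F x * expR (Q x))%:E *
     (expR (l * (usubmx (S x) 0 0 - B x) - 2^-1 * (pivot (A x) * l ^+ 2)))%:E))%E.
    by apply: eq_integral => l _; rewrite fQ -EFinM [in LHS](expRD _ (Q x)); congr EFin; ring.
  rewrite ge0_integralZl_EFin//; last 2 first.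
  - apply/measurable_EFinP; apply: measurableT_comp => //.
    apply: measurable_funB; apply: measurable_funM => //.
    by apply: measurable_funM => //; exact: measurable_funX.
  - by rewrite mulr_ge0 ?expR_ge0.
  rewrite integral_gauss// /schur_factor -!EFinM; congr EFin.
  have := congr1 expR (gexp_schur (S x) z a0); rewrite -/(B x) -/(Q x) [LHS]expRD [RHS]expRD => e.
  rewrite -/c; transitivity (c * F x * (Num.sqrt (pivot (A x)))^-1 *
    (expR (2^-1 * ((pivot (A x))^-1 * (usubmx (S x) 0 0 - B x) ^+ 2)) * expR (Q x))).
    by ring.
  by rewrite -e; ring.
under eq_integral do rewrite fE.
rewrite ge0_integralZl_EFin//.
- move=> x _; rewrite lee_fin mulr_ge0 ?expR_ge0// mulr_ge0//.
  exact: schur_factor_ge0.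
- apply/measurable_EFinP; apply: measurable_funM.
    by apply: measurable_funM => //; exact: measurable_schur_factor.
  apply: measurableT_comp => //; apply: measurable_gexp (mx_measurable_cst z).
    exact: mx_measurable_schur.
  exact: mx_measurable_schur_vec.
- exact: sqrtr_ge0.
Qed.

Lemma gauss_slices_le n (F F' : T -> R) (A A' : T -> 'M[R]_(1 + n))
  (S S' : T -> 'cV[R]_(1 + n)) (z : 'cV[R]_n) :
  (forall x, 0 <= F x) -> measurable_fun setT F -> mx_measurable A -> mx_measurable S ->
  (forall x, 0 <= F' x) -> measurable_fun setT F' -> mx_measurable A' -> mx_measurable S' ->
  (forall lam, (\int[P]_x (F x * expR (gexp (A x) (S x) lam))%:E <=
                \int[P]_x (F' x * expR (gexp (A' x) (S' x) lam))%:E)%E) ->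
  (\int[@lebesgue_measure R]_l \int[P]_x
     (F x * expR (gexp (A x) (S x) (col_mx l%:M z)))%:E <=
   \int[@lebesgue_measure R]_l \int[P]_x
     (F' x * expR (gexp (A' x) (S' x) (col_mx l%:M z)))%:E)%E.
Proof.
move=> F0 mF mA mS F0' mF' mA' mS' H; apply: ge0_le_integral => //.
- move=> l _; apply: integral_ge0 => x _.
  by rewrite lee_fin mulr_ge0 ?expR_ge0.
- apply: (measurable_fun_fubini_tonelli_F (m2 := P) _ (measurable_gauss_integrand z mF mA mS)).
  by move=> lx; rewrite lee_fin mulr_ge0 ?expR_ge0.
- apply: (measurable_fun_fubini_tonelli_F (m2 := P) _ (measurable_gauss_integrand z mF' mA' mS')).
  by move=> lx; rewrite lee_fin mulr_ge0 ?expR_ge0.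
Qed.

(** Transfers an inequality valid for every fixed [lam] to the closed-form mixtures. By induction on
    the dimension, both sides are integrated over the first coordinate and the common factor sqrt (2
    pi) cancels; in dimension 0 only [lam = 0] remains. *)
Lemma gauss_comparison n (F F' : T -> R) (A A' : T -> 'M[R]_n) (S S' : T -> 'cV[R]_n) :
  (forall x, 0 <= F x) -> (forall x, sym_posdef (A x)) ->
  measurable_fun setT F -> mx_measurable A -> mx_measurable S ->
  (forall x, 0 <= F' x) -> (forall x, sym_posdef (A' x)) ->
  measurable_fun setT F' -> mx_measurable A' -> mx_measurable S' ->
  (forall lam, (\int[P]_x (F x * expR (gexp (A x) (S x) lam))%:E <=
                \int[P]_x (F' x * expR (gexp (A' x) (S' x) lam))%:E)%E) ->
  (\int[P]_x (F x * gmix (A x) (S x))%:E <=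
   \int[P]_x (F' x * gmix (A' x) (S' x))%:E)%E.
Proof.
elim: n F F' A A' S S' => [|n IH].
  move=> F F' A A' S S' F0 Ap mF mA mS F0' Ap' mF' mA' mS' H.
  have gE (G : T -> R) (B : T -> 'M[R]_0) U :
    (\int[P]_x (G x * gmix (B x) (U x))%:E = \int[P]_x (G x * expR (gexp (B x) (U x) 0))%:E)%E.
    apply: eq_integral => x _; congr (_ * _)%:E.
    rewrite /gmix /gexp [U x]flatmx0 det_mx00 sqrtr1 invr1 mul1r.
    by rewrite mulmx0 mxE !qformE !bform0l mulr0 subr0.
  by rewrite !gE.
rewrite -(add1n n) => F F' A A' S S' F0 Ap mF mA mS F0' Ap' mF' mA' mS' H.
have gE (G : T -> R) (B : T -> 'M[R]_(1 + n)) (U : T -> 'cV[R]_(1 + n)) : (forall x, sym_posdef (B x)) ->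
    (\int[P]_x (G x * gmix (B x) (U x))%:E = \int[P]_x (G x *
      schur_factor (B x) (U x) * gmix (schur (B x)) (schur_vec (B x) (U x)))%:E)%E.
  by move=> Bp; apply: eq_integral => x _; rewrite (gmix_schur _ (Bp x)) mulrA.
rewrite [X in (X <= _)%E](gE F A S Ap) [X in (_ <= X)%E](gE F' A' S' Ap').
have c0 : 0 < Num.sqrt (2 * pi) :> R by rewrite sqrtr_gt0 mulr_gt0// pi_gt0.
apply: IH.
- by move=> x; rewrite mulr_ge0// schur_factor_ge0.
- by move=> x; exact: posdef_schur.
- by apply: measurable_funM => //; exact: measurable_schur_factor.
- exact: mx_measurable_schur.
- exact: mx_measurable_schur_vec.
- by move=> x; rewrite mulr_ge0// schur_factor_ge0.
- by move=> x; exact: posdef_schur.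
- by apply: measurable_funM => //; exact: measurable_schur_factor.
- exact: mx_measurable_schur.
- exact: mx_measurable_schur_vec.
- move=> z /=; have := gauss_slices_le z F0 mF mA mS F0' mF' mA' mS' H.
  rewrite [X in (X <= _)%E](gauss_step z F0 Ap mF mA mS).
  rewrite [X in (_ <= X)%E](gauss_step z F0' Ap' mF' mA' mS').
  by rewrite lee_pmul2l.
Qed.

End Comparison.
End GaussianMixture.

(** * Ville's inequality *)

Section Ville.
Context {d : measure_display} {T : measurableType d} {R : realType}.
Variables (P : probability T R) (X : nat -> T -> R) (a : R).
Hypotheses (a0 : 0 < a) (X0 : forall t x, 0 <= X t x).
Hypothesis mX : forall t, measurable_fun setT (X t).

Definition below t : set T := [set x | forall s, (s <= t)%N -> X s x < a].

Hypothesis superX : forall t,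
  (\int[P]_(x in below t) (X t.+1 x)%:E <= \int[P]_(x in below t) (X t x)%:E)%E.

Let measurable_lt t : measurable [set x | X t x < a].
Proof.
rewrite -[X in measurable X]setTI.
rewrite (_ : [set x | _] = (X t) @^-1` `]-oo, a[%classic); last first.
  by apply/seteqP; split => x /=; rewrite in_itv.
exact: mX.
Qed.

Lemma belowS t : below t.+1 = below t `&` [set x | X t.+1 x < a].
Proof.
apply/seteqP; split => [x h|x [h1 h2] s].
  by split=> [s st|]; apply: h => //; exact: leqW.
by rewrite leq_eqVlt ltnS => /predU1P[->|/h1].
Qed.

Lemma measurable_below t : measurable (below t).
Proof.
elim: t => [|t IH]; last by rewrite belowS; exact: measurableI.
rewrite (_ : below 0 = [set x | X 0 x < a])//; apply/seteqP; split => [x h|x h s].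
  exact: h.
by rewrite leqn0 => /eqP ->.
Qed.

Let markov t D : measurable D -> (forall x, D x -> a <= X t x) ->
  (a%:E * P D <= \int[P]_(x in D) (X t x)%:E)%E.
Proof.
move=> mD aX; rewrite -integral_cst//; apply: ge0_le_integral => //.
- by move=> x _; rewrite lee_fin ltW.
- by apply/measurable_EFinP; exact: measurable_funTS.
Qed.

Let split_integral t D E : measurable D -> measurable E -> [disjoint D & E] ->
  (\int[P]_(x in D `|` E) (X t x)%:E =
   \int[P]_(x in D) (X t x)%:E + \int[P]_(x in E) (X t x)%:E)%E.
Proof.
move=> mD mE DE; rewrite ge0_integral_setU//.
  by apply/measurable_EFinP; exact: measurable_funTS.
by move=> x _; rewrite lee_fin.
Qed.

(** The left side bounds from below the mean of the process stopped when it first reaches [a], and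
    this mean does not exceed the initial one. *)
Lemma ville_finite t :
  (a%:E * P (~` below t) + \int[P]_(x in below t) (X t x)%:E <=
   \int[P]_x (X 0 x)%:E)%E.
Proof.
elim: t => [|t IH].
  rewrite -[X in (_ <= \int[P]_(x in X) _)%E](setvU (below 0)) split_integral//.
  - rewrite leeD2r// markov//; first exact/measurableC/measurable_below.
    move=> x nb; rewrite leNgt; apply/negP => h; apply: nb => s.
    by rewrite leqn0 => /eqP ->.
  - exact/measurableC/measurable_below.
  - exact: measurable_below.
  - by rewrite disj_set2E setICl.
(* [D] is the event of a first crossing at time [t.+1]. Markov's inequality on [D] pays for its
   probability out of the integral over [below t]. *)
apply: (le_trans _ IH); pose D := below t `&` ~` [set x | X t.+1 x < a].
have mD : measurable D by apply: measurableI; [exact: measurable_below|exact: measurableC].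
have -> : ~` below t.+1 = ~` below t `|` D.
  by rewrite belowS setCI /D setUIr setvU setTI.
rewrite measureU//; last 2 first.
  - exact/measurableC/measurable_below.
  - by rewrite /D setIA setICl set0I.
rewrite ge0_muleDr// -addeA leeD2l//.
apply: (le_trans _ (superX t)).
have tE : below t = D `|` below t.+1.
  by rewrite belowS /D -setIUr setvU setIT.
rewrite [X in (_ <= \int[P]_(x in X) _)%E]tE split_integral//; last 2 first.
  - exact: measurable_below.
  - by rewrite disj_set2E belowS /D setIACA setICl setI0.
rewrite leeD2r// markov// => x [_ /=] /negP; by rewrite -leNgt.
Qed.

Lemma ville : (a%:E * P [set x | exists t, (a <= X t x)%R] <= \int[P]_x (X 0 x)%:E)%E.
Proof.
have -> : [set x | exists t, a <= X t x] = \bigcup_t (~` below t).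
  apply/seteqP; split => [x [t at_]|x [t _ nb]].
    by exists t => // h; have := h t (leqnn t); rewrite ltNge at_.
  apply: contrapT => h; apply: nb => s _; rewrite ltNge; apply/negP => sa.
  by apply: h; exists s.
have cv : P \o (fun t => ~` below t) @ \oo --> P (\bigcup_t (~` below t)).
  apply: nondecreasing_cvg_mu.
  - by move=> t; exact/measurableC/measurable_below.
  - by apply: bigcupT_measurable => t; exact/measurableC/measurable_below.
  - apply/nondecreasing_seqP => t; apply/subsetPset/subsetC.
    by rewrite belowS; exact: subIsetl.
rewrite muleC -lee_pdivlMr//.
apply: (cvge_to_le cv).
near=> t => /=; rewrite lee_pdivlMr// muleC.
apply: le_trans (ville_finite t); rewrite leeDl//.
by apply: integral_ge0 => x _; rewrite lee_fin.
Unshelve. all: by end_near.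
Qed.

End Ville.

(** * Random choice of a member of a countable family of functions *)

Section CountableSlices.
Context {d : measure_display} {T : measurableType d} {R : realType}.
Context (mu : {measure set T -> \bar R}) {I : countType} (z : T -> I) (D : set T).
Hypothesis mz : forall i, measurable (D `&` [set x | z x = i]).

(** Indexing by codes gives a partition over the natural numbers; a number that codes no value
    yields an empty slice. *)
Let slice n : set T := D `&` [set x | pickle (z x) = n].

Let sliceP n : slice n = set0 \/ exists i, slice n = D `&` [set x | z x = i].
Proof.
have [[i pi]|nz] := pselect (exists i : I, pickle i = n); [right|left].
  exists i; congr (_ `&` _); apply/seteqP; split => [x /= zx|x /= ->//].
  by apply: (pcan_inj pickleK); rewrite zx.
apply/seteqP; split=> // x [_ /= zn].
by apply: nz; exists (z x).
Qed.

Let measurable_slice n : measurable (slice n).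
Proof. by have [->|[i ->]] := sliceP n. Qed.

Let slice_cover : D = \bigcup_n slice n.
Proof.
by apply/seteqP; split => [x Dx|x [n _ [//]]]; exists (pickle (z x)).
Qed.

Let trivIset_slice : trivIset setT slice.
Proof. by move=> i j _ _ [x [[_ <-] [_ <-]]]. Qed.

Lemma measurable_slices d' (U : measurableType d') (f : I -> T -> U) :
  (forall i, measurable_fun setT (f i)) ->
  measurable_fun D (fun x => f (z x) x).
Proof.
move=> mf; rewrite slice_cover; apply/(measurable_fun_bigcup _ measurable_slice) => n.
have [->|[i ->]] := sliceP n; first exact: measurable_fun_set0.
apply: (eq_measurable_fun (f i)); last exact: measurable_funTS.
by move=> x; rewrite inE => -[_ /= ->].
Qed.

Lemma le_integral_slices (f g : I -> T -> \bar R) :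
  (forall i x, (0 <= f i x)%E) -> (forall i x, (0 <= g i x)%E) ->
  (forall i, measurable_fun setT (f i)) -> (forall i, measurable_fun setT (g i)) ->
  (forall i, (\int[mu]_(x in D `&` [set x | z x = i]) f i x <=
              \int[mu]_(x in D `&` [set x | z x = i]) g i x)%E) ->
  (\int[mu]_(x in D) f (z x) x <= \int[mu]_(x in D) g (z x) x)%E.
Proof.
move=> f0 g0 mf mg fg.
have mfz := measurable_slices mf; have mgz := measurable_slices mg.
rewrite slice_cover in mfz mgz *.
rewrite !ge0_integral_bigcup//; apply: lee_nneseries => n.
  by move=> _ _; apply: integral_ge0.
move=> _; have [->|[i ->]] := sliceP n; first by rewrite !integral_set0.
rewrite (eq_integral (f i)); last by move=> x; rewrite inE => -[_ /= ->].
by rewrite [leRHS](eq_integral (g i))// => x; rewrite inE => -[_ /= ->].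
Qed.

End CountableSlices.

(** * Conditioning on random directions *)

Lemma limn_einf_le {R : realType} (u : (\bar R)^nat) (b : \bar R) :
  (forall n, u n <= b)%E -> (limn_einf u <= b)%E.
Proof.
move=> ub; rewrite limn_einf_lim; apply: lime_le; first exact: is_cvg_einfs.
apply: nearW => n; apply: le_trans (ub n); apply: ereal_inf_lbound.
by exists n => //=.
Qed.

Section Rounding.
Context {R : realType}.

(** Rounding is downward so that [expR] of the rounded value stays below [expR] of the original,
    with no error term. *)
Definition round_floor (k : nat) (r : R) : R :=
  (Num.floor (k.+1%:R * r))%:~R / k.+1%:R.

Lemma round_floor_le k r : round_floor k r <= r.
Proof.
rewrite /round_floor ler_pdivrMr ?ltr0n// [leRHS]mulrC.
by have /andP[] := floor_itv (k.+1%:R * r).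
Qed.

Lemma cvg_round_floor (r : R) : (fun k => round_floor k r) @ \oo --> r.
Proof.
apply: (@squeeze_cvgr _ _ _ _ (fun k => r - harmonic k) (cst r)).
- apply: nearW => k; rewrite round_floor_le andbT /round_floor /=.
  rewrite ler_pdivlMr ?ltr0n// mulrBl mulVf ?pnatr_eq0// lerBlDr [leLHS]mulrC.
  have /andP[_] := floor_itv (k.+1%:R * r); rewrite intrD => /ltW.
  by rewrite mulr1z.
- rewrite -[X in _ --> X](subr0 r); apply: cvgB; first exact: cvg_cst.
  exact: cvg_harmonic.
- exact: cvg_cst.
Qed.

Lemma cvg_finite_sum (I : Type) (s : seq I) (f : I -> nat -> R) (l : I -> R) :
  (forall i, f i k @[k --> \oo] --> l i) ->
  (\sum_(i <- s) f i k) @[k --> \oo] --> \sum_(i <- s) l i.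
Proof.
move=> fl; elim: s => [|i s IH].
  by rewrite big_nil; under eq_fun do rewrite big_nil; exact: cvg_cst.
by rewrite big_cons; under eq_fun do rewrite big_cons; exact: cvgD.
Qed.

Lemma cvg_qform n (A : 'M[R]_n) (u : nat -> 'cV[R]_n) (v : 'cV[R]_n) :
  (forall i, u k i 0 @[k --> \oo] --> v i 0) ->
  qform A (u k) @[k --> \oo] --> qform A v.
Proof.
move=> uv; rewrite qform_sum; under eq_fun do rewrite qform_sum.
apply: cvg_finite_sum => i; apply: cvg_finite_sum => j.
by apply: cvgM; [exact: cvg_cst|exact: cvgM].
Qed.

Lemma cvg_gexp n (A : 'M[R]_n) S (u : nat -> 'cV[R]_n) (v : 'cV[R]_n) :
  (forall i, u k i 0 @[k --> \oo] --> v i 0) ->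
  gexp A S (u k) @[k --> \oo] --> gexp A S v.
Proof.
move=> uv; rewrite /gexp; apply: cvgB.
  rewrite mxE; under eq_fun do rewrite mxE.
  apply: cvg_finite_sum => i; rewrite mxE; under eq_fun do rewrite mxE.
  by apply: cvgM => //; exact: cvg_cst.
by apply: cvgM; [exact: cvg_cst|exact: cvg_qform].
Qed.

End Rounding.

Section Conditioning.
Context {d : measure_display} {T : measurableType d} {R : realType}.
Variables (P : probability T R) (G : set (set T)).
Hypothesis Gm : G `<=` measurable.

Lemma sub_sigma_measurable : <<s G >> `<=` (measurable : set (set T)).
Proof. exact: smallest_sub (sigma_algebra_measurable T) Gm. Qed.

Lemma sub_sigma_measurable_fun d' (U : measurableType d') (f : T -> U) :
  @measurable_fun _ _ (g_sigma_algebraType G) U setT f -> measurable_fun setT f.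
Proof. by move=> mf _ B mB; apply: sub_sigma_measurable; exact: mf. Qed.

Lemma cond_exp_le_integral (X : T -> R) (c : R) (A : set T) : (forall x, 0 <= X x) ->
  measurable_fun setT X -> 0 <= c -> cond_exp_le P <<s G >> X c -> <<s G >> A ->
  (\int[P]_(x in A) (X x)%:E <= c%:E * P A)%E.
Proof.
move=> X0 mX c0 [Z [mZ [ZX Zc]]] GA; rewrite -ZX//.
have mA := sub_sigma_measurable GA.
have mZ' : measurable_fun setT Z.
  by move=> _ B mB; rewrite setTI; apply: sub_sigma_measurable; exact: mZ.
(* [Z] may take negative values; its positive part is still almost everywhere at most [c] because
   [0 <= c]. *)
rewrite integralE; apply: (@le_trans _ _ (\int[P]_(x in A) Z^\+ x)%E).
  by rewrite geeDl// oppe_le0; exact: integral_ge0.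
rewrite -integral_cst//; apply: ae_ge0_le_integral => //.
- by apply: measurable_funTS; exact: measurable_funepos.
- apply: filterS Zc => x Zx _.
  by rewrite funeposE ge_max Zx lee_fin.
Qed.

End Conditioning.

Section RandomDirection.
Context {d : measure_display} {T : measurableType d} {R : realType}.
Variables (P : probability T R) (G : set (set T)).
Hypothesis Gm : G `<=` measurable.
Local Notation T' := (g_sigma_algebraType G).

(* Rounding g and nu makes them countably valued, so that the deterministic
   bound applies on each level set; Fatou removes the rounding. *)
Lemma subgaussian_random_direction m (D : set T) (g : T -> R)
  (nu w : T -> 'cV[R]_m) (B : 'M[R]_m) :
  measurable_fun (setT : set T') (g : T' -> R) ->
  mx_measurable (nu : T' -> _) -> mx_measurable w -> <<s G >> D ->
  (forall A v, <<s G >> A ->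
     (\int[P]_(x in A) (expR ((v^T *m w x) 0 0))%:E <=
      (expR (2^-1 * qform B v))%:E * P A)%E) ->
  (\int[P]_(x in D) (expR (g x + gexp B (w x) (nu x)))%:E <=
   \int[P]_(x in D) (expR (g x))%:E)%E.
Proof.
move=> mg mnu mw GD sub.
have mD := sub_sigma_measurable Gm GD.
(* Integer codes of the rounded pair; [dg k] and [dv k] decode them on the grid of mesh 1/(k+1). *)
pose I := (int * 'cV[int]_m)%type.
pose z k x : I := (Num.floor (k.+1%:R * g x), \col_i Num.floor (k.+1%:R * nu x i 0)).
pose dg k (i : I) : R := i.1%:~R / k.+1%:R.
pose dv k (i : I) : 'cV[R]_m := \col_j ((i.2 j 0)%:~R / k.+1%:R).
have floorm (f : T' -> R) k n : measurable_fun setT f ->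
    <<s G >> [set x | Num.floor (k.+1%:R * f x) = n].
  move=> mf.
  have mkf : measurable_fun setT (fun x => k.+1%:R * f x) by exact: measurable_funM.
  have := mkf measurableT `[n%:~R, (n + 1)%:~R[%classic (measurable_itv _).
  rewrite setTI; congr (<<s G >> _); apply/seteqP; split => x /=.
    by rewrite in_itv => /floor_def.
  by rewrite in_itv /= => /eqP; rewrite floor_eq.
have mz k i : <<s G >> (D `&` [set x | z k x = i]).
  have -> : [set x | z k x = i] = [set x | Num.floor (k.+1%:R * g x) = i.1] `&`
      \bigcap_(j in setT) [set x | Num.floor (k.+1%:R * nu x j 0) = i.2 j 0].
    case: i => a b; apply/seteqP; split => x /=.
      by move=> [<- <-]; split=> // j _; rewrite mxE.
    move=> [<- h]; congr pair; apply/matrixP => p q; rewrite ord1 mxE.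
    exact: h.
  apply: (@measurableI _ T') => //; apply: (@measurableI _ T').
    exact: floorm.
  apply: (@fin_bigcap_measurable _ T') => // j _.
  exact: floorm.
have mz' k i := sub_sigma_measurable Gm (mz k i).
pose f k (i : I) x : \bar R := (expR (dg k i + gexp B (w x) (dv k i)))%:E.
have mf k i : measurable_fun setT (f k i).
  apply/measurable_EFinP; apply: measurableT_comp => //.
  apply: measurable_funD => //.
  exact: measurable_gexp (mx_measurable_cst B) mw (mx_measurable_cst _).
have dgE k x : dg k (z k x) = round_floor k (g x) by [].
have le_k k : (\int[P]_(x in D) f k (z k x) x <= \int[P]_(x in D) (expR (g x))%:E)%E.
  apply: (@le_trans _ _ (\int[P]_(x in D) (expR (dg k (z k x)))%:E)%E).
    apply: (le_integral_slices (mz' k) (f := f k)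
        (g := fun i (_ : T) => (expR (dg k i))%:E)) => // i.
      by move=> x; rewrite lee_fin expR_ge0.
    rewrite [leRHS](_ : _ = ((expR (dg k i))%:E * P (D `&` [set x | z k x = i]))%E); last exact: integral_cst.
    (* On a level set this factor is deterministic, and its quadratic term cancels the exponent of
       the sub-Gaussian bound exactly. *)
    pose K := expR (dg k i - 2^-1 * qform B (dv k i)).
    have fK x : f k i x = (K%:E * (expR (((dv k i)^T *m w x) 0 0))%:E)%E.
      by rewrite /f /K /gexp -EFinM -expRD; congr (expR _)%:E; ring.
    under eq_integral do rewrite fK.
    rewrite ge0_integralZl_EFin//; last 2 first.
    - apply/measurable_EFinP; apply: measurableT_comp => //; apply: measurable_funTS.
      exact: (mx_measurableM (mx_measurable_cst _) mw).
    - exact: expR_ge0.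
    apply: (@le_trans _ _ (K%:E * ((expR (2^-1 * qform B (dv k i)))%:E *
        P (D `&` [set x | z k x = i])))%E).
      by rewrite lee_wpmul2l ?lee_fin ?expR_ge0//; exact: sub.
    by rewrite muleA -EFinM /K -expRD subrK.
  apply: ge0_le_integral => //.
  - apply: (measurable_slices (mz' k) (f := fun i (_ : T) => (expR (dg k i))%:E)) => i.
    exact: measurable_cst.
  - apply/measurable_EFinP; apply: measurableT_comp => //; apply: measurable_funTS.
    exact: sub_sigma_measurable_fun mg.
  - by move=> x _; rewrite lee_fin ler_expR dgE round_floor_le.
have limf x : f k (z k x) x @[k --> \oo] --> (expR (g x + gexp B (w x) (nu x)))%:E.
  apply: cvg_EFin; first exact: nearW.
  apply: (@cvg_comp _ _ _ (fun k => dg k (z k x) + gexp B (w x) (dv k (z k x))) expR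
    _ _ _ _ (@continuous_expR R _)).
  apply: cvgD; first exact: cvg_round_floor.
  apply: cvg_gexp => i; under eq_fun do rewrite mxE /= mxE.
  exact: cvg_round_floor.
apply: (@le_trans _ _ (limn_einf (fun k => \int[P]_(x in D) f k (z k x) x))%E).
  rewrite (eq_integral (fun x => limn_einf (fun k => f k (z k x) x))); last first.
    by move=> x _; have [-> _] := cvg_limn_einf_sup (limf x).
  apply: (@fatou _ _ _ _ _ mD (fun k x => f k (z k x) x)) => [k|k x _].
    exact: (measurable_slices (mz' k)).
  by rewrite lee_fin expR_ge0.
exact: limn_einf_le.
Qed.

End RandomDirection.

(** * The confidence event *)

Section SpectralRadiusMeasurability.
Context {R : realType} {n : nat}.

(** Both sides are homogeneous of degree 2, so integer vectors yield all grid points k^-1 z; the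
    closed inequality then passes to the limit. *)
Lemma qform_le_integer (A B : 'M[R]_n) (c : R) :
  (forall z : 'cV[int]_n, qform A (map_mx intr z) <= c * qform B (map_mx intr z)) ->
  forall x, qform A x <= c * qform B x.
Proof.
move=> h x; pose u k : 'cV[R]_n := \col_i round_floor k (x i 0).
have ux i : u k i 0 @[k --> \oo] --> x i 0.
  by under eq_fun do rewrite mxE; exact: cvg_round_floor.
have uA := cvg_qform (A := A) ux; have uB := cvgM (cvg_cst c) (cvg_qform (A := B) ux).
apply: (@ler_cvg_to _ \oo _ _ (fun k => qform A (u k)) (fun k => c * qform B (u k))
  (qform A x) (c * qform B x)).
- exact: uA.
- exact: uB.
apply: nearW => k; pose z : 'cV[int]_n := \col_i Num.floor (k.+1%:R * x i 0).
have -> : u k = k.+1%:R^-1 *: map_mx intr z.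
  by apply/matrixP => i j; rewrite (ord1 j) !mxE mulrC.
rewrite !qformE !bformZl !bformZr (mulrCA c) (mulrCA c).
by rewrite !ler_wpM2l ?invr_ge0 ?ler0n//; exact: h.
Qed.

Context {d : measure_display} {T : measurableType d}.

(** For [0 <= c], a spectral radius at most [c] means that [U] is dominated by [c] times [V x], a
    countable intersection of conditions on integer vectors. *)
Lemma measurable_spectral_radius (V : T -> 'M[R]_n) (U : 'M[R]_n) :
  mx_measurable V -> (forall x, V x \in unitmx -> sym_posdef (V x)) -> sym_posdef U ->
  measurable_fun setT
    (fun x => if V x \in unitmx then spectral_radius (invmx (V x) *m U) else 0).
Proof.
move=> mV Vp Up.
have mu := measurable_unitmx mV.
apply: (measurability _ (RGenOInfty.measurableE R)) => _ [_ [c ->] <-].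
rewrite setTI -[X in measurable X]setCK; apply: measurableC.
have [c0|c0] := ltP c 0.
  rewrite (_ : ~` _ = set0)//; apply/seteqP; split => // x /=.
  rewrite in_itv/= andbT; case: ifP => xu; apply; rewrite ?(lt_le_trans c0)//.
  exact: spectral_radius_ge0.
(* A number that codes no vector is sent to 0, where the condition reads 0 <= 0. *)
pose dec k : 'cV[R]_n := map_mx intr (odflt 0 (unpickle k : option 'cV[int]_n)).
rewrite (_ : ~` _ = ~` [set x | V x \in unitmx] `|`
    \bigcap_k [set x | qform U (dec k) <= c * qform (V x) (dec k)]); last first.
  apply/seteqP; split => x /=; rewrite in_itv/= andbT.
    case: ifP => xu /negP; rewrite -leNgt => h; [right|by left] => k _ /=.
    apply: le_trans (qform_le_spectral_radius (Vp _ xu) Up _) _.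
    by rewrite ler_wpM2r// (sym_posdef_psd (Vp _ xu)).2.
  case=> [/negP xu|h]; apply/negP; rewrite -leNgt; case: ifP => xu'.
  - by rewrite xu' in xu.
  - by [].
  - apply: spectral_radius_le => //; first exact: Vp.
    apply: qform_le_integer => z.
    by have := h (pickle z) I; rewrite /= /dec pickleK.
  - by [].
apply: measurableU.
  apply: measurableC; rewrite -[X in measurable X]setTI.
  exact: (mu measurableT [set true]).
apply: bigcapT_measurable => k; rewrite -[X in measurable X]setTI.
apply: (@measurable_fun_ler _ _ _ _ (cst (qform U (dec k)))
   (fun x => c * qform (V x) (dec k)) _ _ measurableT [set true]) => //.
by apply: measurable_funM => //; apply: measurable_qform => //; exact: mx_measurable_cst.
Qed.

End SpectralRadiusMeasurability.

(** * The regularized cost and its normal equations *)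

Section LeastSquares.
Context {R : realType} {m n : nat}.
Variables (M : nat -> 'M[R]_(m, n)) (W : 'M[R]_m) (y : nat -> 'cV[R]_m).
Hypothesis Wp : sym_posdef W.

Lemma bform_gram (A : 'M[R]_(m, n)) h k :
  bform (A^T *m W *m A) h k = bform W (A *m h) (A *m k).
Proof. by rewrite /bform trmx_mul !mulmxA. Qed.

Lemma Vt_sym t : (Vt M W t)^T = Vt M W t.
Proof.
rewrite /Vt linear_sum; apply: eq_bigr => k _.
by rewrite /= !trmx_mul trmxK Wp.1 mulmxA.
Qed.

Lemma bform_sum (I : Type) (r : seq I) (A : I -> 'M[R]_n) h k :
  bform (\sum_(i <- r) A i) h k = \sum_(i <- r) bform (A i) h k.
Proof. by rewrite /bform mulmx_sumr mulmx_suml summxE. Qed.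

Lemma qform_Vt t h : qform (Vt M W t) h = \sum_(k < t) qform W (M k *m h).
Proof.
by rewrite qformE /Vt bform_sum; apply: eq_bigr => k _; rewrite bform_gram.
Qed.

Lemma Vt_psd t : sym_psd (Vt M W t).
Proof.
split=> [|h]; first exact: Vt_sym.
rewrite qform_Vt; apply: sumr_ge0 => k _.
exact: (sym_posdef_psd Wp).2.
Qed.

(** Under the model this is the sum of M_k^T W w_k; written with the outputs, it is visibly a
    function of the data. *)
Definition score (theta : 'cV[R]_n) t : 'cV[R]_n :=
  \sum_(k < t) (M k)^T *m W *m (y k.+1 - M k *m theta).

Variables (P : 'M[R]_n) (mu theta : 'cV[R]_n).
Hypothesis Pp : sym_psd P.

(** Half the gradient of the cost at [th], expanded around [theta] so that the estimation error
    appears. *)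
Definition rls_gradient t (th : 'cV[R]_n) : 'cV[R]_n :=
  (P + Vt M W t) *m (th - theta) + (P *m (theta - mu) - score theta t).

Lemma rls_cost_shift t th h : rls_cost P mu W M y t (th + h) =
  rls_cost P mu W M y t th + 2 * (h^T *m rls_gradient t th) 0 0
  + qform (P + Vt M W t) h.
Proof.
rewrite /rls_cost.
have -> : qform P (th + h - mu) = qform P (th - mu) + 2 * bform P h (th - mu) + qform P h.
  by rewrite (addrAC th) (qform_add (th - mu) h Pp.1) (bformC (th - mu) h Pp.1).
have Wk k : qform W (y k.+1 - M k *m (th + h)) = qform W (y k.+1 - M k *m th)
    - 2 * bform W (M k *m h) (y k.+1 - M k *m th) + qform W (M k *m h).
  rewrite mulmxDr opprD addrA -(scaleN1r (M k *m h)) (qform_add (y k.+1 - M k *m th) _ Wp.1).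
  rewrite bformZr [qform W (-1 *: _)]qformE bformZl bformZr -qformE.
  rewrite (bformC (y k.+1 - M k *m th) (M k *m h) Wp.1); ring.
under eq_bigr do rewrite Wk.
rewrite big_split sumrB /= -qform_Vt -mulr_sumr.
have -> : (h^T *m rls_gradient t th) 0 0 = bform P h (th - mu) -
    \sum_(k < t) bform W (M k *m h) (y k.+1 - M k *m th).
  have -> : rls_gradient t th = P *m (th - mu) -
     \sum_(k < t) (M k)^T *m W *m (y k.+1 - M k *m th).
    rewrite /rls_gradient /score mulmxDl /Vt.
    have -> : th - mu = (th - theta) + (theta - mu) by rewrite addrA subrK.
    rewrite (mulmxDr P (th - theta)) -addrA -[RHS]addrA; congr (_ + _).
    rewrite addrCA; congr (_ + _).
    rewrite mulmx_suml -sumrB -sumrN; apply: eq_bigr => k _.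
    rewrite -(mulmxA _ _ (th - theta)) -(mulmxBr ((M k)^T *m W)) -[RHS]mulmxN.
    congr (_ *m _).
    by rewrite mulmxBr !opprB addrA subrK.
  rewrite mulmxBr mxE [X in _ + X]mxE; congr (_ - _); first by rewrite /bform mulmxA.
  rewrite mulmx_sumr summxE; apply: eq_bigr => k _.
  by rewrite /bform trmx_mul !mulmxA.
rewrite [qform (P + _) h]qformE bform_add -!qformE; ring.
Qed.

Lemma rls_minimizerP t th : sym_posdef (P + Vt M W t) ->
  (forall th', rls_cost P mu W M y t th <= rls_cost P mu W M y t th') <->
  theta - th = invmx (P + Vt M W t) *m (P *m (theta - mu) - score theta t).
Proof.
move=> Ap; have uA := posdef_unit Ap; set A := P + _ in Ap uA *.
have -> : (theta - th = invmx A *m (P *m (theta - mu) - score theta t)) <->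
    rls_gradient t th = 0.
  split=> [e|].
    by rewrite /rls_gradient -/A -(opprB theta th) e mulmxN mulKVmx// addNr.
  rewrite /rls_gradient -/A => /eqP; rewrite addrC addr_eq0 => /eqP ->.
  by rewrite -mulmxN opprB mulKmx.
split=> [h|r0 th'].
  (* The Newton step: moving by [- z] changes the cost by [- qform A z], so minimality forces
     [z = 0]. *)
  pose z := invmx A *m rls_gradient t th.
  have := h (th + (-1) *: z); rewrite rls_cost_shift -/A.
  have -> : ((-1 *: z)^T *m rls_gradient t th) 0 0 = - qform A z.
    rewrite linearZ/= -scalemxAl mxE mulN1r; congr (- _).
    by rewrite /qform -mulmxA mulKVmx.
  rewrite [qform A (-1 *: z)]qformE bformZl bformZr -qformE => q.
  have [z0|/Ap.2 zp] := eqVneq z 0; last by exfalso; lra.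
  by rewrite -(mulKVmx uA (rls_gradient t th)) -/z z0 mulmx0.
rewrite -(subrK th th') (addrC _ th) rls_cost_shift r0 mulmx0 mxE mulr0 addr0.
by rewrite lerDl (sym_posdef_psd Ap).2.
Qed.

End LeastSquares.

(** * From a bound on the mixture to a bound on the error, for one outcome *)

Section DeterministicBound.
Context {R : realType} {n : nat}.
Implicit Types (P V U : 'M[R]_n) (S : 'cV[R]_n).

(** Square and take logarithms: the ratio of determinants becomes [\det (1 + U^-1 V)], and squaring
    [delta^-1] produces the factor 2. *)
Lemma gmix_lt_log V U S (delta : R) : sym_posdef U -> sym_posdef (U + V) ->
  0 < delta -> gmix (U + V) S < (Num.sqrt (\det U))^-1 / delta ->
  qform (invmx (U + V)) S <= ln (\det (1%:M + invmx U *m V)) + 2 * ln delta^-1.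
Proof.
move=> Up Bp d0.
have dU := posdef_det_gt0 Up; have dB := posdef_det_gt0 Bp.
have -> : 1%:M + invmx U *m V = invmx U *m (U + V).
  by rewrite mulmxDr mulVmx// posdef_unit.
rewrite det_mulmx det_inv /gmix; set q := qform _ _.
have sU : 0 < Num.sqrt (\det U) by rewrite sqrtr_gt0.
have sB : 0 < Num.sqrt (\det (U + V)) by rewrite sqrtr_gt0.
rewrite mulrC ltr_pdivrMr// => h.
have : expR q < ((Num.sqrt (\det U))^-1 / delta * Num.sqrt (\det (U + V))) ^+ 2.
  have -> : expR q = expR (2^-1 * q) ^+ 2.
    by rewrite -expRM_natl mulrA divff ?mul1r.
  by rewrite ltrXn2r// ?expR_ge0// !mulr_ge0 ?invr_ge0 ?ltW.
rewrite !exprMn !exprVn !sqr_sqrtr ?(ltW dU) ?(ltW dB)// => {}h.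
rewrite -(expRK q); apply: ltW.
have -> : 2 * ln delta^-1 = ln (delta ^- 2).
  by rewrite -exprVn lnXn ?invr_gt0// mulr_natl.
have pU : 0 < (\det U)^-1 by rewrite invr_gt0.
have p2 : 0 < delta ^- 2 by rewrite invr_gt0 exprn_gt0.
rewrite -lnM ?posrE ?mulr_gt0// ltr_ln ?posrE ?expR_gt0 ?mulr_gt0//.
by rewrite mulrAC.
Qed.

Lemma wnorm_le_beta P V U (u S : 'cV[R]_n) (cth cw delta : R) :
  sym_psd P -> sym_posdef V -> sym_posdef U -> 0 <= cth -> wnorm P u <= cth ->
  qform (invmx (U + V)) S <= ln (\det (1%:M + invmx U *m V)) + 2 * ln delta^-1 ->
  wnorm (P + V) (invmx (P + V) *m (P *m u - cw *: S)) <= beta V U cth cw delta.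
Proof.
move=> Pp Vp Up c0 uc qS.
have P0 := Pp.2; have V0 := (sym_posdef_psd Vp).2.
have Ap : sym_posdef (P + V).
  split=> [|x x0]; first by rewrite linearD/= Pp.1 Vp.1.
  by rewrite qformE bform_add -!qformE ltr_wpDl//; exact: Vp.2.
have Bp : sym_posdef (U + V).
  split=> [|x x0]; first by rewrite linearD/= Up.1 Vp.1.
  by rewrite qformE bform_add -!qformE addr_gt0//; [exact: Up.2|exact: Vp.2].
have uA := posdef_unit Ap; have uB := posdef_unit Bp.
pose kap := 1 + spectral_radius (invmx V *m U).
have kap1 : 1 <= kap by rewrite lerDl; exact: spectral_radius_ge0.
have kap0 : 0 < kap by apply: lt_le_trans kap1.
set e := invmx (P + V) *m _.
have eqe : qform (P + V) e = bform P e u - cw * (e^T *m S) 0 0.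
  rewrite /qform -mulmxA mulKVmx// mulmxBr -scalemxAr mulmxA.
  by rewrite mxE [X in _ + X]mxE [X in _ - X]mxE.
have uP : qform P u <= cth ^+ 2.
  by rewrite -(sqr_sqrtr (P0 u)) lerXn2r// nnegrE sqrtr_ge0.
have h1 := psd_young e u Pp ltr01; rewrite invr1 !mul1r in h1.
(* The weight [kap] is chosen so that the resulting [kap^-1 * qform (U + V) e] is at most
   [qform V e]. Together with the term [qform P e] from [h1] this is one copy of the squared norm of
   [e], absorbed by the two copies on the left. *)
have h2 := psd_young (- cw *: (invmx (U + V) *m S)) e (sym_posdef_psd Bp) kap0.
have h3 : kap^-1 * qform (U + V) e <= qform V e.
  rewrite ler_pdivrMl// qformE bform_add -!qformE /kap mulrDl mul1r addrC lerD2l.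
  exact: qform_le_spectral_radius.
rewrite bformZl (bform_invl _ _ Bp.1 uB) [qform _ (- cw *: _)]qformE in h2.
rewrite bformZl bformZr -qformE (qform_inv _ Bp.1 uB) (dotmxC S) in h2.
have eAV : qform (P + V) e = qform P e + qform V e by rewrite qformE bform_add.
set q := qform (invmx (U + V)) S in qS h2.
set L := ln _ + _ in qS.
have qL : kap * cw ^+ 2 * q <= kap * cw ^+ 2 * L.
  by rewrite ler_wpM2l// mulr_ge0 ?sqr_ge0// ltW.
(* Enlarging this term lets [kap] factor out of the whole bound, as in [beta]. *)
have cthk : cth ^+ 2 <= kap * cth ^+ 2 by rewrite ler_peMl// sqr_ge0.
have bound : qform (P + V) e <= kap * (cth ^+ 2 + cw ^+ 2 * L).
  rewrite mulrDr mulrA; lra.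
rewrite /wnorm /beta -/kap -sqrtrM ?(ltW kap0)//; apply: ler_wsqrtr.
apply: (le_trans bound); rewrite le_eqVlt; apply/orP; left; apply/eqP.
by rewrite /L; ring.
Qed.

End DeterministicBound.

(** * The supermartingale property of the Gaussian mixture *)

Section Supermartingale.
Context {R : realType} {m n : nat}.
Variables (W : 'M[R]_m) (theta : 'cV[R]_n) (U : 'M[R]_n) (cw : R).

Definition scaled_score (M : nat -> 'M[R]_(m, n)) (y : nat -> 'cV[R]_m) t :=
  cw^-1 *: score M W y theta t.

Definition mixture (M : nat -> 'M[R]_(m, n)) (y : nat -> 'cV[R]_m) t : R :=
  gmix (U + Vt M W t) (scaled_score M y t).

Lemma mixture0 M y : mixture M y 0 = (Num.sqrt (\det U))^-1.
Proof.
rewrite /mixture /scaled_score /Vt /score !big_ord0 addr0 scaler0.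
by rewrite /gmix qformE bform0l mulr0 expR0 mulr1.
Qed.

Lemma gexpD (A B : 'M[R]_n) S Z lam :
  gexp (A + B) (S + Z) lam = gexp A S lam + gexp B Z lam.
Proof.
rewrite /gexp mulmxDr mxE [qform (A + B) _]qformE bform_add -!qformE; ring.
Qed.

(** Turns the increment in direction [lam] into the sub-Gaussian exponent of the noise in the
    direction cw^-1 W A lam; the scaling by [cw] makes the quadratic terms equal. *)
Lemma gexp_increment (A : 'M[R]_(m, n)) v lam : sym_posdef W -> 0 < cw ->
  gexp (A^T *m W *m A) (cw^-1 *: (A^T *m W *m v)) lam =
  gexp (cw ^+ 2 *: invmx W) v (cw^-1 *: (W *m (A *m lam))).
Proof.
move=> Wp cw0; have uW := posdef_unit Wp; rewrite /gexp; congr (_ - _ * _).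
  rewrite -scalemxAr [in RHS]linearZ/= -scalemxAl !trmx_mul Wp.1.
  by rewrite !mulmxA.
rewrite !qformE bform_gram bform_scale bformZl bformZr -[in RHS]qformE.
have -> : qform (invmx W) (W *m (A *m lam)) = bform W (A *m lam) (A *m lam).
  by rewrite -(qform_inv _ Wp.1 uW) mulKmx.
by field; rewrite gt_eqF.
Qed.

Section Measurability.
Context {d : measure_display} {T : measurableType d}.
Variables (M : nat -> T -> 'M[R]_(m, n)) (y : nat -> T -> 'cV[R]_m) (t : nat).
Hypothesis mM : forall k, (k < t)%N -> mx_measurable (M k).
Hypothesis my : forall k, (k < t)%N -> mx_measurable (y k.+1).

Lemma mx_measurable_Vt : mx_measurable (fun x => Vt (M^~ x) W t).
Proof.
apply: mx_measurable_sum => k; apply: mx_measurableM; last exact: mM.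
by apply: mx_measurableM (mx_measurable_cst W); apply: mx_measurable_tr; exact: mM.
Qed.

Lemma mx_measurable_score : mx_measurable (fun x => score (M^~ x) W (y^~ x) theta t).
Proof.
apply: mx_measurable_sum => k; apply: mx_measurableM.
  by apply: mx_measurableM (mx_measurable_cst W); apply: mx_measurable_tr; exact: mM.
apply: mx_measurableB; first exact: my.
by apply: mx_measurableM (mx_measurable_cst theta); exact: mM.
Qed.

Lemma mx_measurable_scaled_score :
  mx_measurable (fun x => scaled_score (M^~ x) (y^~ x) t).
Proof. by apply: mx_measurableZ => //; exact: mx_measurable_score. Qed.

Lemma measurable_mixture : measurable_fun setT (fun x => mixture (M^~ x) (y^~ x) t).
Proof.
apply: measurable_gmix mx_measurable_scaled_score.
exact: mx_measurableD (mx_measurable_cst U) mx_measurable_Vt.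
Qed.

End Measurability.

Context {d : measure_display} {T : measurableType d} (P : probability T R).
Variables (M : nat -> T -> 'M[R]_(m, n)) (y w : nat -> T -> 'cV[R]_m).
Hypothesis mM : forall t, mx_measurable (M t).
Hypothesis my : forall t, mx_measurable (y t).
Hypothesis mw : forall t, mx_measurable (w t).
Hypotheses (Wp : sym_posdef W) (Up : sym_posdef U) (cw0 : 0 < cw).

Lemma data_gen_measurable t : data_gen M y t `<=` measurable.
Proof.
move=> _ [k [B [mB [[i [j [_ ->]]]|[i [_ ->]]]]]].
  by rewrite -[X in measurable X]setTI; exact: mM.
by rewrite -[X in measurable X]setTI; exact: my.
Qed.

Local Notation data_type t := (g_sigma_algebraType (data_gen M y t)).

Lemma data_measurable_M t k : (k <= t)%N -> mx_measurable (M k : data_type t -> _).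
Proof.
move=> kt i j _ B mB; rewrite setTI; apply: sub_gen_smallest.
by exists k, B; split=> //; left; exists i, j.
Qed.

Lemma data_measurable_y t k : (0 < k <= t)%N -> mx_measurable (y k : data_type t -> _).
Proof.
move=> kt i j _ B mB; rewrite setTI; apply: sub_gen_smallest.
by exists k, B; split=> //; right; exists i; rewrite (ord1 j).
Qed.

Lemma mixture_supermartingale t D :
  (forall x, y t.+1 x = M t x *m theta + w t x) ->
  (forall nu : 'cV[R]_m,
     cond_exp_le P (data_sigma M y t) (fun x => expR ((nu^T *m w t x) 0 0))
       (expR (2^-1 * cw ^+ 2 * qform (invmx W) nu))) ->
  data_sigma M y t D ->
  (\int[P]_(x in D) (mixture (M^~ x) (y^~ x) t.+1)%:E <=
   \int[P]_(x in D) (mixture (M^~ x) (y^~ x) t)%:E)%E.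
Proof.
move=> yE sub GD; have Gm := @data_gen_measurable t.
have mD := sub_sigma_measurable Gm GD.
(* [gauss_comparison] integrates over the whole space, so [D] is carried by the weight, as its
   indicator. *)
have indicE' (f : T -> R) :
    (\int[P]_(x in D) (f x)%:E = \int[P]_x (\1_D x * f x)%:E)%E.
  rewrite integral_mkcond; apply: eq_integral => x _.
  rewrite patchE indicE; case: ifPn => _; first by rewrite mul1r.
  by rewrite mul0r.
have posU s x : sym_posdef (U + Vt (M^~ x) W s).
  split=> [|z z0]; first by rewrite linearD/= Up.1 Vt_sym.
  rewrite qformE bform_add -!qformE ltr_pwDl ?Up.2//.
  exact: (Vt_psd _ Wp _).2.
rewrite [X in (X <= _)%E]indicE' [X in (_ <= X)%E]indicE'.
have F0 x : 0 <= \1_D x :> R by rewrite indicE ler0n.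
have mF : measurable_fun setT (\1_D : T -> R) by exact: measurable_indic.
have mA s : mx_measurable (fun x => U + Vt (M^~ x) W s).
  by apply: mx_measurableD (mx_measurable_cst U) _; exact: mx_measurable_Vt.
have mS s : mx_measurable (fun x => scaled_score (M^~ x) (y^~ x) s).
  exact: mx_measurable_scaled_score.
apply: (gauss_comparison F0 (posU t.+1) mF (mA _) (mS _) F0 (posU t) mF (mA _) (mS _)).
move=> lam.
pose g x := gexp (U + Vt (M^~ x) W t) (scaled_score (M^~ x) (y^~ x) t) lam.
pose B := cw ^+ 2 *: invmx W.
pose nu x := cw^-1 *: (W *m (M t x *m lam)).
rewrite -[X in (X <= _)%E]indicE' -[X in (_ <= X)%E]indicE'.
apply: (@le_trans _ _
    (\int[P]_(x in D) (expR (g x + gexp B (w t x) (nu x)))%:E)%E).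
  rewrite le_eqVlt; apply/orP; left; apply/eqP.
  apply: eq_integral => x _; congr (expR _)%:E.
  rewrite /g -gexp_increment// -gexpD -addrA; congr (gexp (_ + _) _ _).
    by rewrite /Vt big_ord_recr.
  rewrite /scaled_score -scalerDr; congr (_ *: _).
  by rewrite /score big_ord_recr /= yE addrAC subrr add0r.
apply: (subgaussian_random_direction (G := data_gen M y t)) => //.
- apply: measurable_gexp (mx_measurable_cst lam).
    apply: mx_measurableD (mx_measurable_cst U) _; apply: mx_measurable_Vt => k kt.
    exact: data_measurable_M (ltnW kt).
  apply: mx_measurable_scaled_score => k kt; first exact: data_measurable_M (ltnW kt).
  exact: data_measurable_y.
- apply: mx_measurableZ => //; apply: mx_measurableM (mx_measurable_cst W) _.
  by apply: mx_measurableM (mx_measurable_cst lam); exact: data_measurable_M.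
- move=> A v GA; rewrite /B qformE bform_scale mulrA.
  apply: (cond_exp_le_integral Gm _ _ _ (sub v) GA) => //.
    by apply: measurableT_comp => //; apply: (mx_measurableM (mx_measurable_cst _) (mw t)).
Qed.

End Supermartingale.

Lemma measurable_confidence_event {d : measure_display} {T : measurableType d}
  {R : realType} n (V : T -> 'M[R]_n) (N : T -> 'cV[R]_n) (U Pm : 'M[R]_n)
  (u : 'cV[R]_n) (cth cw delta : R) :
  mx_measurable V -> mx_measurable N -> (forall x, V x \in unitmx -> sym_posdef (V x)) ->
  sym_posdef U ->
  measurable [set x | V x \in unitmx ->
    wnorm (Pm + V x) (invmx (Pm + V x) *m (Pm *m u - N x)) <= beta (V x) U cth cw delta].
Proof.
move=> mV mN Vp Up.
pose rho x := if V x \in unitmx then spectral_radius (invmx (V x) *m U) else 0.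
pose b x := Num.sqrt (1 + rho x) *
  Num.sqrt (cth ^+ 2 + cw ^+ 2 * ln (\det (1%:M + invmx U *m V x))
            + 2 * cw ^+ 2 * ln (delta^-1)).
pose lhs x := wnorm (Pm + V x) (invmx (Pm + V x) *m (Pm *m u - N x)).
rewrite (_ : [set x | _] = ~` [set x | V x \in unitmx] `|` [set x | lhs x <= b x]); last first.
  apply/seteqP; split => x /=.
    have [xu|xu _] := boolP (V x \in unitmx); last by left; exact/negP.
    by move=> /(_ isT); right; rewrite /b /rho xu.
  by move=> [//|h xu]; move: h; rewrite /b /rho xu.
have mb : measurable_fun setT b.
  apply: measurable_funM; apply: measurable_fun_sqrt; apply: measurable_funD => //.
    exact: measurable_spectral_radius.
  apply: measurable_funD => //; apply: measurable_funM => //.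
  apply: measurableT_comp => //; apply: measurable_det.
  apply: mx_measurableD (mx_measurable_cst _) _.
  exact: mx_measurableM (mx_measurable_cst _) mV.
have mPV : mx_measurable (fun x => Pm + V x).
  exact: mx_measurableD (mx_measurable_cst _) mV.
have ml : measurable_fun setT lhs.
  apply: measurable_fun_sqrt; apply: measurable_qform => //.
  apply: mx_measurableM; first exact: mx_measurable_inv.
  exact: mx_measurableB (mx_measurable_cst _) mN.
have mu := measurable_unitmx mV; have mlb := measurable_fun_ler ml mb.
apply: measurableU; last by rewrite -[X in measurable X]setTI; exact: (mlb measurableT [set true]).
by apply: measurableC; rewrite -[X in measurable X]setTI; exact: (mu measurableT [set true]).
Qed.

Unset Implicit Arguments.

Theorem theorem3 (d : measure_display) (Omega : measurableType d) (R : realType)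
  (P : probability Omega R) (m n : nat) (Tm : option nat)
  (M : nat -> Omega -> 'M[R]_(m, n)) (y : nat -> Omega -> 'cV[R]_m)
  (w : nat -> Omega -> 'cV[R]_m) (theta_star : 'cV[R]_n)
  (W : 'M[R]_m) (mu : 'cV[R]_n) (Pm : 'M[R]_n) (cw cth : R)
  (Vbar : 'M[R]_n) (delta : R) :
  (forall t (i : 'I_m) (j : 'I_n), measurable_fun setT (fun x => M t x i j)) ->
  (forall t (i : 'I_m), measurable_fun setT (fun x => w t x i 0)) ->
  (forall t (i : 'I_m), measurable_fun setT (fun x => y t x i 0)) ->
  (forall t x, le_Tm1 Tm t -> y t.+1 x = M t x *m theta_star + w t x) ->
  sym_posdef W -> sym_psd Pm ->
  0 < cw ->
  (forall t, le_Tm1 Tm t -> forall nu : 'cV[R]_m,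
     cond_exp_le P (data_sigma M y t) (fun x => expR ((nu^T *m w t x) 0 0))
       (expR (2^-1 * cw ^+ 2 * qform (invmx W) nu))) ->
  0 <= cth -> wnorm Pm (theta_star - mu) <= cth ->
  sym_posdef Vbar ->
  0 < delta < 1 ->
  (P [set x | forall t, le_T Tm t ->
      let V := Vt (fun k => M k x) W t in
      V \in unitmx ->
      forall th_hat : 'cV[R]_n,
        (forall th, rls_cost Pm mu W (fun k => M k x) (fun k => y k x) t th_hat
                    <= rls_cost Pm mu W (fun k => M k x) (fun k => y k x) t th)%R ->
        (wnorm (Pm + V) (theta_star - th_hat) <= beta V Vbar cth cw delta)%R]
   >= (1 - delta)%:E)%E.
Proof.
move=> mM mw' my' yE Wp Pp cw0 sub cth0 thmu Up /andP[d0 _].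
have mw t : mx_measurable (w t) by move=> i j; rewrite (ord1 j); exact: mw'.
have my t : mx_measurable (y t) by move=> i j; rewrite (ord1 j); exact: my'.
(* The process is frozen at the horizon: the model and the noise bound stop there, while the maximal
   inequality runs over all times. *)
pose hor t := if Tm is Some T then minn t T else t.
have hor_le t : (hor t <= t)%N by rewrite /hor; case: (Tm) => // T; exact: geq_minl.
have hor_id t : le_T Tm t -> hor t = t.
  by rewrite /hor; case: (Tm) => //= T /minn_idPl.
pose Y t x := mixture W theta_star Vbar cw (M^~ x) (y^~ x) (hor t).
(* The initial value of the mixture divided by [delta], so that the level is reached with
   probability at most [delta]. *)
pose a := (Num.sqrt (\det Vbar))^-1 / delta.
have dU0 : 0 < (Num.sqrt (\det Vbar))^-1 by rewrite invr_gt0 sqrtr_gt0 posdef_det_gt0.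
have a0 : 0 < a by rewrite divr_gt0.
have mY t : measurable_fun setT (Y t).
  by apply: measurable_mixture => k _; [exact: mM|exact: my].
have GY t : data_sigma M y t (below Y a t).
  (* Measurability of [below] is proved for processes measurable at all times; stopping the index at
     [t] makes every term measurable for the data at time [t]. *)
  have -> : below Y a t = below (fun s => Y (minn s t)) a t.
    apply/seteqP; split => x h s st; first by rewrite (minn_idPl st); exact: h.
    by have := h s st; rewrite (minn_idPl st).
  apply: (@measurable_below _ (g_sigma_algebraType (data_gen M y t))) => s.
  have hs : (hor (minn s t) <= t)%N by rewrite (leq_trans (hor_le _))// geq_minr.
  apply: measurable_mixture => k ks.
    by apply: data_measurable_M; rewrite ltnW// (leq_trans ks).
  by apply: data_measurable_y; rewrite (leq_trans ks).
have superY t :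
    (\int[P]_(x in below Y a t) (Y t.+1 x)%:E <= \int[P]_(x in below Y a t) (Y t x)%:E)%E.
  have [tT|tT] := boolP (le_Tm1 Tm t); last first.
    suff e : hor t.+1 = hor t by rewrite /Y e.
    move: tT; rewrite /hor; case: (Tm) => //= T; rewrite -leqNgt => Tt.
    by rewrite !(minn_idPr _)// leqW.
  have e1 : hor t.+1 = t.+1 by apply: hor_id; move: tT; case: (Tm).
  have e0 : hor t = t by apply: hor_id; move: tT; case: (Tm) => //= T; exact: ltnW.
  rewrite /Y e1 e0 -/Y; apply: mixture_supermartingale (sub _ tT) (GY t) => // x.
  exact: yE.
have Y0 t x : 0 <= Y t x by exact: gmix_ge0.
have := ville a0 Y0 mY superY.
set bad := [set x | exists t, a <= Y t x].
have -> : (\int[P]_x (Y 0 x)%:E = ((Num.sqrt (\det Vbar))^-1)%:E)%E.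
  rewrite (eq_integral (cst (Num.sqrt (\det Vbar))^-1%:E)).
    by rewrite integral_cst// -[RHS]mule1; congr (_ * _)%E; exact: probability_setT.

  move=> x _; rewrite /Y (_ : hor 0 = 0%N) ?mixture0//.
  by apply/eqP; rewrite -leqn0.
move=> Pbad.
have mbad : measurable bad.
  rewrite (_ : bad = \bigcup_t [set x | a <= Y t x]); last first.
    by apply/seteqP; split=> x [t]; [exists t|move=> _ h; exists t].
  apply: bigcupT_measurable => t; rewrite -[X in measurable X]setTI.
  have mle : measurable_fun setT (fun x => a <= Y t x).
    by apply: measurable_fun_ler => //; exact: mY.
  exact: (mle measurableT [set true]).
pose N t x := score (M^~ x) W (y^~ x) theta_star t.
pose E t := [set x | Vt (M^~ x) W t \in unitmx ->
  wnorm (Pm + Vt (M^~ x) W t) (invmx (Pm + Vt (M^~ x) W t) *m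
    (Pm *m (theta_star - mu) - N t x)) <= beta (Vt (M^~ x) W t) Vbar cth cw delta].
have Vp t x : Vt (M^~ x) W t \in unitmx -> sym_posdef (Vt (M^~ x) W t).
  by apply: psd_unit_posdef; exact: Vt_psd.
have mE t : measurable (E t).
  apply: measurable_confidence_event; [| |exact: Vp|exact: Up].
    by apply: mx_measurable_Vt => k _; exact: mM.
  by apply: mx_measurable_score => k _; [exact: mM|exact: my].
have PVp t x : Vt (M^~ x) W t \in unitmx -> sym_posdef (Pm + Vt (M^~ x) W t).
  move=> uV; have Vxp := Vp _ _ uV; split=> [|z z0]; first by rewrite linearD/= Pp.1 Vxp.1.
  by rewrite qformE bform_add -!qformE ltr_wpDl ?Pp.2 ?Vxp.2.
have minP t x th : Vt (M^~ x) W t \in unitmx ->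
    (forall th', rls_cost Pm mu W (M^~ x) (y^~ x) t th <=
                 rls_cost Pm mu W (M^~ x) (y^~ x) t th') <->
    theta_star - th = invmx (Pm + Vt (M^~ x) W t) *m (Pm *m (theta_star - mu) - N t x).
  by move=> /PVp PVxp; exact: rls_minimizerP.
set good := [set x | _].
(* Positive definiteness of [Pm + V] makes the minimizer exist and be unique, so the quantifier over
   [th_hat] reduces to the explicit error, and the event to a countable intersection. *)
have goodE : good = \bigcap_(t in [set t | le_T Tm t]) E t.
  apply/seteqP; split => x h t tT.
    move=> uV; have := h t tT uV; set z := invmx _ *m _ => /(_ (theta_star - z)).
    by rewrite subKr; apply; apply/(minP _ _ _ uV); rewrite subKr.
  move=> uV th /(minP _ _ _ uV) ->.
  exact: (h t tT uV).
have mgood : measurable good.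
  rewrite goodE; apply: bigcap_measurableType => t _; exact: mE.
have sub_good : ~` bad `<=` good.
  rewrite goodE => x nbad t tT uV.
  have -> : N t x = cw *: scaled_score W theta_star cw (M^~ x) (y^~ x) t.
    by rewrite /scaled_score scalerA divff ?gt_eqF// scale1r.
  apply: wnorm_le_beta => //; first exact: Vp.
  apply: gmix_lt_log => //.
    have Vxp := Vp _ _ uV; split=> [|z z0]; first by rewrite linearD/= Up.1 Vxp.1.
    by rewrite qformE bform_add -!qformE addr_gt0 ?Up.2 ?Vxp.2.
  rewrite ltNge; apply/negP => h; apply: nbad; exists t.
  by rewrite /Y hor_id.
apply: (@le_trans _ _ (P (~` bad))); last by apply: le_measure; rewrite ?inE//; exact: measurableC.
rewrite probability_setC// EFinB; apply: leeB => //.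
move: Pbad; rewrite /a EFinM -muleA -[leRHS]mule1 lee_pmul2l// muleC => Pbad.
rewrite -(@lee_pmul2r _ delta^-1%:E) ?lte_fin ?invr_gt0//.
by rewrite -EFinM divff ?gt_eqF.
Qed.
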